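(* Let $A$ and $B$ be non-trivial recursively presented groups, where $B$ acts on a set $S$ transitively, so $S=B/H$ where $H$ is the stabiliser of some arbitrary point $s_0\in S$. The conjugacy problem in the permutational restricted wreath product $A\wr_S B$ is solvable if: (i) the conjugacy problem is solvable in $A$ and in $B$; (ii) either $A$ is abelian or the orbit order problem is solvable in $B$; (iii) the membership problem for $H\gamma\langle\beta\rangle$ (for any $\gamma,\beta\in B$) is solvable; and (iv) for any $\beta\in B$ and any finite set of $n$ pairs of elements $(\alpha_i,\gamma_i)$, where $\alpha_i,\gamma_i\in B$ and $1\le i\le n$, one can determine whether or not $\big[\bigcap_{i=1}^n \alpha_i^{-1}H\gamma_i\langle\beta\rangle\big]\cap C_B(\beta)=\emptyset$.
   Context: A group is recursively presented if it has a presentation with finitely many generators and a recursively enumerable set of relators. Elements are given as words in the generators. The conjugacy problem is solvable if an algorithm decides, for any two words in the generators, whether they represent conjugate elements. $C_B(\beta)$ is the centraliser of $\beta$ in $B$. $B$ acts on $S$ on the right, and $S$ is identified with the set $B/H$ of right cosets $Ht$ ($t\in B$) via $s_0t\leftrightarrow Ht$. For $b\in B$, a $b$-orbit is an orbit of $\langle b\rangle$ on $S$. Permutational restricted wreath product: $A\wr_S B=\{(b,f): b\in B,\ f\in A^{(S)}\}$, where $A^{(S)}$ is the group (pointwise multiplication) of functions $f:S\to A$ with finite support $\sigma(f)=\{s: f(s)\ne 1_A\}$, $f^{c}(s)=f(sc^{-1})$, and $(b,f)(c,g)=(bc,f^{c}g)$. It is generated by the elements $(b,1)$ with $b$ a generator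 of $B$ and $(1_B,a^{(s_0)})$ with $a$ a generator of $A$, where $a^{(s)}$ takes the value $a$ at $s$ and $1_A$ elsewhere. Orbit order problem: decide, for any $b\in B$ and any $b$-orbit in $S$ (given by a representative $s_0t$, $t\in B$), whether that $b$-orbit is finite (equivalently, decide for any $b\in B$ whether $H\langle b\rangle$ contains finitely or infinitely many right $H$-cosets). Membership problem for $H\gamma\langle\beta\rangle$: there is an algorithm which, given words for $\gamma,\beta,w\in B$, decides whether $w\in H\gamma\langle\beta\rangle$. In (iv), ''can determine'' means there is an algorithm taking $\beta$ and the pairs $(\alpha_i,\gamma_i)$ as input. *)

(* Defs.v *)
From HB Require Import structures.
From mathcomp Require Import all_boot.
From mathcomp Require Import finmap.
From mathcomp Require Import classical_sets cardinality.

Set Implicit Arguments.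
Unset Strict Implicit.
Unset Printing Implicit Defensive.

Local Open Scope classical_set_scope.
Local Open Scope group_scope.

(* Data types on which algorithms operate: everything built from the natural
   numbers by finite products and finite lists. *)
Inductive dtype : Type :=
  | tnat
  | tprod of dtype & dtype
  | tlist of dtype.

Fixpoint dval (t : dtype) : Type :=
  match t with
  | tnat => nat
  | tprod t1 t2 => (dval t1 * dval t2)%type
  | tlist t1 => seq (dval t1)
  end.

Coercion dval : dtype >-> Sortclass.

(* The total recursive functions, by Kleene's schemes: basic functions,
   composition, primitive recursion (over numbers and over lists) and regular
   minimisation, i.e. minimisation of a total function under the proviso that
   a zero always exists.  Up to a standard Goedel numbering of pairs and
   lists, these are exactly the total recursive functions on the natural
   numbers. *)
Inductive computable : forall s t : dtype, (s -> t) -> Prop :=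
  | computable_ext (s t : dtype) (f g : s -> t) :
      f =1 g -> computable f -> computable g
  | computable_id (t : dtype) : computable (fun x : t => x)
  | computable_comp (r s t : dtype) (f : r -> s) (g : s -> t) :
      computable f -> computable g -> computable (fun x : r => g (f x))
  | computable_pair (r s t : dtype) (f : r -> s) (g : r -> t) :
      computable f -> computable g ->
      @computable r (tprod s t) (fun x : r => (f x, g x))
  | computable_fst (s t : dtype) :
      @computable (tprod s t) s (fun x : s * t => x.1)
  | computable_snd (s t : dtype) :
      @computable (tprod s t) t (fun x : s * t => x.2)
  | computable_zero (s : dtype) : @computable s tnat (fun _ : s => 0%N)
  | computable_succ : @computable tnat tnat (fun n : nat => n.+1)
  | computable_natrec (s t : dtype) (f : s -> t) (g : s * (nat * t) -> t) :
      computable f -> @computable (tprod s (tprod tnat t)) t g ->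
      @computable (tprod s tnat) t
        (fun x : s * nat => iteri x.2 (fun i y => g (x.1, (i, y))) (f x.1))
  | computable_nil (s t : dtype) :
      @computable s (tlist t) (fun _ : s => [::] : seq t)
  | computable_cons (t : dtype) :
      @computable (tprod t (tlist t)) (tlist t)
        (fun x : t * seq t => x.1 :: x.2)
  | computable_listrec (s t u : dtype) (f : s -> u) (g : s * (t * u) -> u) :
      computable f -> @computable (tprod s (tprod t u)) u g ->
      @computable (tprod s (tlist t)) u
        (fun x : s * seq t => foldr (fun a y => g (x.1, (a, y))) (f x.1) x.2)
  | computable_mu (s : dtype) (g : s * nat -> nat)
      (g_zero : forall x : s, exists n : nat, g (x, n) == 0%N) :
      @computable (tprod s tnat) tnat g ->
      @computable s tnat (fun x : s => ex_minn (g_zero x)).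

(* The instances x : X of the problem P are presented to the algorithm through
   the coding enc; its behaviour on data that code no instance is
   irrelevant. *)
Definition decided_by_algorithm (X : Type) (t : dtype) (enc : X -> t)
    (P : X -> Prop) : Prop :=
  exists2 f : t -> nat, @computable t tnat f
    & forall x : X, P x <-> f (enc x) <> 0%N.

(* Words in m generators: the letter (i, false) is the i-th generator and
   (i, true) is its inverse. *)
Definition word (m : nat) : Type := seq ('I_m * bool).

Definition tword : dtype := tlist (tprod tnat tnat).

Definition code_word (m : nat) (w : word m) : tword :=
  [seq (val x.1, nat_of_bool x.2) | x <- w].

Definition code_word2 (m : nat) (p : word m * word m) : tprod tword tword :=
  (code_word p.1, code_word p.2).

Definition code_word3 (m : nat) (p : word m * word m * word m) :
    tprod (tprod tword tword) tword :=
  (code_word2 p.1, code_word p.2).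

Definition code_word_pairs (m : nat) (p : word m * seq (word m * word m)) :
    tprod tword (tlist (tprod tword tword)) :=
  (code_word p.1, [seq code_word2 q | q <- p.2]).

Definition eval_word (G : groupType) (m : nat) (g : 'I_m -> G) (w : word m) :
    G :=
  \prod_(x <- w) (if x.2 then (g x.1)^-1 else g x.1).

(* The empty set is included: e may output data that code no word. *)
Definition recursively_enumerable (m : nat) (R : set (word m)) : Prop :=
  exists2 e : nat -> tword, @computable tnat tword e
    & forall w : word m, R w <-> exists n : nat, e n = code_word w.

(* Two words represent the same element of the group < X | R >. *)
Inductive pres_eq (m : nat) (R : set (word m)) : word m -> word m -> Prop :=
  | pres_refl u : pres_eq R u u
  | pres_sym u v : pres_eq R u v -> pres_eq R v u
  | pres_trans u v w : pres_eq R u v -> pres_eq R v w -> pres_eq R u w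
  | pres_cat u u' v v' :
      pres_eq R u u' -> pres_eq R v v' -> pres_eq R (u ++ v) (u' ++ v')
  | pres_cancel i b : pres_eq R [:: (i, b); (i, ~~ b)] [::]
  | pres_relator r : R r -> pres_eq R r [::].

Definition presentation (G : groupType) (m : nat) (g : 'I_m -> G)
    (R : set (word m)) : Prop :=
  (forall x : G, exists w : word m, eval_word g w = x) /\
  (forall u v : word m, eval_word g u = eval_word g v <-> pres_eq R u v).

Definition recursively_presented (G : groupType) (m : nat) (g : 'I_m -> G) :
    Prop :=
  exists2 R : set (word m), recursively_enumerable R & presentation g R.

Definition conjugate (G : groupType) (x y : G) : Prop :=
  exists z : G, x ^ z = y.

Definition conjugacy_problem_solvable (G : groupType) (m : nat)
    (g : 'I_m -> G) : Prop :=
  decided_by_algorithm (@code_word2 m)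
    (fun p => conjugate (eval_word g p.1) (eval_word g p.2)).

Record right_action (B : groupType) (S : Type) := RightAction {
  ract :> S -> B -> S;
  ract1 : forall s : S, ract s 1 = s;
  ractM : forall (s : S) (b c : B), ract s (b * c) = ract (ract s b) c
}.

Definition transitive_action (B : groupType) (S : Type)
    (to : right_action B S) : Prop :=
  forall s t : S, exists b : B, to s b = t.

Definition stabiliser (B : groupType) (S : Type) (to : right_action B S)
    (s : S) : set B :=
  [set b | to s b = s].

Definition powers (G : groupType) (x : G) : set G :=
  [set y | exists n : nat, y = x ^+ n \/ y = x ^- n].

Definition centraliser (G : groupType) (x : G) : set G :=
  [set y | commute x y].

(* The parameter to does not occur in the fields; it is there because the group
   law depends on it. *)
Record wreath (A B : groupType) (S : choiceType) (to : right_action B S) :=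
  Wreath { wr_base : B; wr_fun : {fsfun S -> A with 1} }.

Arguments Wreath {A B S} to _ _.

Section WreathProduct.
Variables (A B : groupType) (S : choiceType) (to : right_action B S).

Local Notation wreath := (wreath A to).

Implicit Types (f g : {fsfun S -> A with 1}) (b c : B) (s : S).

Definition pair_of_wreath (x : wreath) : B * {fsfun S -> A with 1} :=
  (wr_base x, wr_fun x).

Definition wreath_of_pair (p : B * {fsfun S -> A with 1}) : wreath :=
  Wreath to p.1 p.2.

Lemma pair_of_wreathK : cancel pair_of_wreath wreath_of_pair.
Proof. by case. Qed.

HB.instance Definition _ := Choice.copy wreath (can_type pair_of_wreathK).

(* f^c, with f^c(s) = f(s c^-1); its support is the translate by c of the
   support of f *)
Definition fs_shift f c : {fsfun S -> A with 1} :=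
  [fsfun s in [fset to x c | x in finsupp f]%fset => f (to s c^-1) | 1].

Definition fs_mul f g : {fsfun S -> A with 1} :=
  [fsfun s in (finsupp f `|` finsupp g)%fset => f s * g s | 1].

Definition fs_inv f : {fsfun S -> A with 1} :=
  [fsfun s in finsupp f => (f s)^-1 | 1].

(* a^(s); its support is empty when a = 1 *)
Definition fs_single s (a : A) : {fsfun S -> A with 1} :=
  [fsfun x in [fset s]%fset => a | 1].

Definition wr_one : wreath := Wreath to 1 [fsfun with 1].

Definition wr_mul (x y : wreath) : wreath :=
  Wreath to (wr_base x * wr_base y)
    (fs_mul (fs_shift (wr_fun x) (wr_base y)) (wr_fun y)).

Definition wr_inv (x : wreath) : wreath :=
  Wreath to (wr_base x)^-1 (fs_shift (fs_inv (wr_fun x)) (wr_base x)^-1).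

Lemma ractK b : cancel (to^~ b) (to^~ b^-1).
Proof. by move=> s; rewrite -ractM mulgV ract1. Qed.

Lemma ractKV b : cancel (to^~ b^-1) (to^~ b).
Proof. by move=> s; rewrite -ractM mulVg ract1. Qed.

Lemma fs_shiftE f c s : fs_shift f c s = f (to s c^-1).
Proof.
rewrite fsfunE; case: ifPn => // sNf; apply/esym/fsfun_dflt.
apply: contraNN sNf => sf; apply/imfsetP; exists (to s c^-1) => //=.
by rewrite ractKV.
Qed.

Lemma fs_mulE f g s : fs_mul f g s = f s * g s.
Proof.
rewrite fsfunE in_fsetU; case: ifPn => //.
by rewrite negb_or => /andP[sf sg]; rewrite !fsfun_dflt // mulg1.
Qed.

Lemma fs_invE f s : fs_inv f s = (f s)^-1.
Proof. by rewrite fsfunE; case: finsuppP => // _; rewrite invg1. Qed.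

Lemma fs_singleE s a x : fs_single s a x = if x == s then a else 1.
Proof. by rewrite fsfunE in_fset1. Qed.

Lemma wr_mulA : associative wr_mul.
Proof.
move=> [b f] [c g] [d h]; congr Wreath; first exact: mulgA.
apply/fsfunP => s; rewrite /= !(fs_mulE, fs_shiftE).
by rewrite mulgA invgM ractM.
Qed.

Lemma wr_mul1g : left_id wr_one wr_mul.
Proof.
move=> [b f]; congr Wreath; first exact: mul1g.
by apply/fsfunP => s; rewrite /= fs_mulE fs_shiftE fsfun0E mul1g.
Qed.

Lemma wr_mulg1 : right_id wr_one wr_mul.
Proof.
move=> [b f]; congr Wreath; first exact: mulg1.
by apply/fsfunP => s; rewrite /= fs_mulE fs_shiftE fsfun0E mulg1 invg1 ract1.
Qed.

Lemma wr_mulVg : left_inverse wr_one wr_inv wr_mul.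
Proof.
move=> [b f]; congr Wreath; first exact: mulVg.
apply/fsfunP => s; rewrite /= fs_mulE !fs_shiftE fs_invE fsfun0E.
by rewrite invgK ractKV mulVg.
Qed.

Lemma wr_mulgV : right_inverse wr_one wr_inv wr_mul.
Proof.
move=> [b f]; congr Wreath; first exact: mulgV.
apply/fsfunP => s; rewrite /= fs_mulE !fs_shiftE fs_invE fsfun0E.
by rewrite mulgV.
Qed.

HB.instance Definition _ :=
  isGroup.Build wreath wr_mulA wr_mul1g wr_mulg1 wr_mulVg wr_mulgV.

Definition wr_gen (s0 : S) (m n : nat) (gA : 'I_m -> A) (gB : 'I_n -> B)
    (i : 'I_(n + m)) : wreath :=
  match split i with
  | inl j => Wreath to (gB j) [fsfun with 1]
  | inr j => Wreath to 1 (fs_single s0 (gA j))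
  end.

End WreathProduct.

Section DecisionProblems.
Variables (B : groupType) (S : Type) (to : right_action B S) (s0 : S).
Variables (n : nat) (gB : 'I_n -> B).

Local Notation H := (stabiliser to s0).
Local Notation ev := (eval_word gB).

(* input (b, t) *)
Definition orbit_order_problem_solvable : Prop :=
  decided_by_algorithm (@code_word2 n)
    (fun p => finite_set [set to (to s0 (ev p.2)) x | x in powers (ev p.1)]).

(* input ((gamma, beta), w) *)
Definition membership_problem_solvable : Prop :=
  decided_by_algorithm (@code_word3 n)
    (fun p => [set h * ev p.1.1 * x | h in H & x in powers (ev p.1.2)]
                (ev p.2)).

(* input (beta, [:: (alpha_1, gamma_1); ...; (alpha_n, gamma_n)]); for the
   empty list the intersection is B, so that the answer is trivially
   "nonempty" *)
Definition centraliser_intersection_problem_solvable : Prop :=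
  decided_by_algorithm (@code_word_pairs n)
    (fun p =>
       \bigcap_(q in [set` p.2])
          [set (ev q.1)^-1 * h * ev q.2 * x | h in H & x in powers (ev p.1)]
       `&` centraliser (ev p.1) = set0).

End DecisionProblems.

(* Main.v *)
(* Elements of A wr_S B are written (b, f).  Conjugating by (1, h) replaces
   f by f' with f(s) h(s) = h(s b^-1) f'(s), so it slides the values of f along
   the b-orbits, which do not interact.  Sliding merges all values of f on one
   b-orbit into a single value at a point of that orbit; this value is determined
   by the conjugacy class if the orbit is infinite, and up to conjugacy in A if
   it is finite.  Two elements with base part b, put in this form with nontrivial
   values p_i at s_0 t_i and r_j at s_0 u_j, are therefore conjugate if and only
   if there are equally many p_i and r_j and some d in C_B(b) carries the b-orbit
   of each s_0 t_i to that of some s_0 u_j with p_i and r_j matching, that is,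
   d lies in t_i^-1 H u_j <b>.  There are finitely many ways to assign a j to
   every i, and (iv) decides each of them.  The normal forms need not be computed
   from f: they exist and can be recognised, so unbounded search finds one. *)

From HB Require Import structures.
Require Import Defs.
From mathcomp Require Import all_boot.
From mathcomp Require Import finmap.
From mathcomp Require Import boolp classical_sets cardinality.

Set Implicit Arguments.
Unset Strict Implicit.
Unset Printing Implicit Defensive.

(** * Computable functions on coded types *)

Section ComputableFunctions.
Implicit Types r s t u : dtype.

Lemma computable_pair2 r s t u (f : r -> s) (g : t -> u) :
  computable f -> computable g ->
  @computable (tprod r t) (tprod s u) (fun x => (f x.1, g x.2)).
Proof.
move=> cf cg; apply: computable_pair.
  exact: (computable_comp (computable_fst _ _) cf).
exact: (computable_comp (computable_snd _ _) cg).
Qed.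

Lemma computable_cst s t (c : t) : computable (fun _ : s => c).
Proof.
elim: t s c => [|t1 IH1 t2 IH2|t IH] s c.
- elim: c => [|c IHc]; first exact: computable_zero.
  exact: (computable_comp IHc computable_succ).
- by case: c => c1 c2; apply: (computable_pair (IH1 s c1) (IH2 s c2)).
- elim: c => [|x c IHc]; first exact: computable_nil.
  exact: (computable_comp (computable_pair (IH s x) IHc) (computable_cons t)).
Qed.

Lemma computable_map s t (f : s -> t) :
  computable f -> @computable (tlist s) (tlist t) (map f).
Proof.
move=> cf.
have cg : @computable (tprod tnat (tprod s (tlist t))) (tlist t)
    (fun x => f x.2.1 :: x.2.2).
  refine (@computable_comp (tprod tnat (tprod s (tlist t)))
    (tprod t (tlist t)) _ (fun x => (f x.2.1, x.2.2)) _ _ (computable_cons t)).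
  exact: (computable_comp (computable_snd _ _)
           (computable_pair2 cf (computable_id _))).
apply: (@computable_ext (tlist s) (tlist t)
  (fun l => foldr (fun a y => f a :: y) [::] l)); first by elim=> //= a l ->.
(* List recursion takes a parameter besides the list; the constant 0 fills that slot. *)
exact: (@computable_comp (tlist s) (tprod tnat (tlist s)) (tlist t)
  (fun l => (0, l)) _
  (computable_pair (computable_cst _ (0 : tnat)) (computable_id _))
  (computable_listrec (computable_nil tnat t) cg)).
Qed.

End ComputableFunctions.

(* [cdec] makes every datum the code of some instance: unbounded search is
   only available for functions that are total on all data. *)
Record coded := Coded {
  csort :> Type;
  cdt : dtype;
  cenc : csort -> cdt;
  cdec : cdt -> csort;
  cencK : cancel cenc cdec;
  cdec_computable : computable (fun c => cenc (cdec c)) }.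

(** [F] is tied to [f] only on codes of elements of [X], and [f] itself may be defined classically.
    With boolean values, this is decidability of a predicate. *)
Definition rcomp (X Y : coded) (f : X -> Y) : Prop :=
  exists2 F : cdt X -> cdt Y, computable F & forall x, F (cenc x) = cenc (f x).

Canonical dtype_coded (t : dtype) : coded :=
  @Coded t t id id (fun x : t => erefl x) (computable_id t).

Canonical nat_coded : coded :=
  @Coded nat tnat id id (fun x : nat => erefl x) (computable_id tnat).

Section CodedInstances.
Variables X Y : coded.

Definition pair_enc (p : X * Y) : tprod (cdt X) (cdt Y) :=
  (cenc p.1, cenc p.2).
Definition pair_dec (p : tprod (cdt X) (cdt Y)) : X * Y :=
  (cdec p.1, cdec p.2).

Lemma pair_encK : cancel pair_enc pair_dec.
Proof. by case=> x y; rewrite /pair_dec /= !cencK. Qed.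

Lemma pair_dec_computable : computable (fun c => pair_enc (pair_dec c)).
Proof. exact: computable_pair2 (cdec_computable X) (cdec_computable Y). Qed.

Canonical pair_coded : coded :=
  @Coded (X * Y) (tprod (cdt X) (cdt Y)) _ _ pair_encK pair_dec_computable.

Definition seq_enc (l : seq X) : tlist (cdt X) := map (@cenc X) l.
Definition seq_dec (l : tlist (cdt X)) : seq X := map (@cdec X) l.

Lemma seq_encK : cancel seq_enc seq_dec.
Proof. exact: mapK (@cencK X). Qed.

Lemma seq_dec_computable : computable (fun c => seq_enc (seq_dec c)).
Proof.
apply: (computable_ext _ (computable_map (cdec_computable X))) => c.
by rewrite /seq_enc -map_comp.
Qed.

Canonical seq_coded : coded :=
  @Coded (seq X) (tlist (cdt X)) _ _ seq_encK seq_dec_computable.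

End CodedInstances.

(** * Closure properties of functions realised on codes *)

Section RealisedFunctions.
Implicit Types T X Y Z : coded.

Lemma rcomp_ext X Y (f g : X -> Y) : f =1 g -> rcomp f -> rcomp g.
Proof. by move=> fg [F cF FE]; exists F => // x; rewrite FE fg. Qed.

Lemma rcomp_id X : rcomp (fun x : X => x).
Proof. by exists id; first exact: computable_id. Qed.

Lemma rcomp_comp X Y Z (g : Y -> Z) (f : X -> Y) :
  rcomp g -> rcomp f -> rcomp (fun x => g (f x)).
Proof.
move=> [G cG GE] [F cF FE]; exists (fun x => G (F x)).
  exact: computable_comp cF cG.
by move=> x; rewrite FE GE.
Qed.

Lemma rcomp_cst X Y (y : Y) : rcomp (fun _ : X => y).
Proof. by exists (fun _ => cenc y); first exact: computable_cst. Qed.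

Lemma rcomp_pair T X Y (f : T -> X) (g : T -> Y) :
  rcomp f -> rcomp g -> rcomp (fun t => (f t, g t)).
Proof.
move=> [F cF FE] [G cG GE]; exists (fun x => (F x, G x)).
  exact: computable_pair.
by move=> x; rewrite FE GE.
Qed.

Lemma rcomp_fst T X Y (f : T -> X * Y) : rcomp f -> rcomp (fun t => (f t).1).
Proof.
apply: rcomp_comp; exists (fun x : cdt (pair_coded X Y) => x.1) => //.
exact: computable_fst.
Qed.

Lemma rcomp_snd T X Y (f : T -> X * Y) : rcomp f -> rcomp (fun t => (f t).2).
Proof.
apply: rcomp_comp; exists (fun x : cdt (pair_coded X Y) => x.2) => //.
exact: computable_snd.
Qed.

Lemma rcomp_succ T (f : T -> nat) : rcomp f -> rcomp (fun t => (f t).+1).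
Proof.
apply: (rcomp_comp (g := S)); exists S => //; exact: computable_succ.
Qed.

(** The environment [T] becomes the parameter of primitive recursion, so the number of rounds, the
    step and the start may all depend on it. *)
Lemma rcomp_iteri T X (n : T -> nat) (g : T -> nat -> X -> X) (f : T -> X) :
  rcomp n -> rcomp (fun p : T * (nat * X) => g p.1 p.2.1 p.2.2) -> rcomp f ->
  rcomp (fun t => iteri (n t) (g t) (f t)).
Proof.
move=> cn [G cG GE] [F cF FE].
apply: (@rcomp_comp T (pair_coded T nat_coded) X
  (fun p : T * nat => iteri p.2 (g p.1) (f p.1)) (fun t => (t, n t)));
  last first.
  by apply: rcomp_pair => //; exact: rcomp_id.
exists (fun x : cdt T * nat => iteri x.2 (fun i y => G (x.1, (i, y))) (F x.1)).
  exact: (computable_natrec cF cG).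
case=> t k /=; rewrite FE; elim: k => //= k ->.
by rewrite -(GE (t, (k, _))).
Qed.

Lemma rcomp_cons T X (f : T -> X) (g : T -> seq X) :
  rcomp f -> rcomp g -> rcomp (fun t => f t :: g t).
Proof.
move=> cf cg; apply: (rcomp_comp (g := fun p : X * seq X => p.1 :: p.2)
  (f := fun t => (f t, g t))); last exact: rcomp_pair.
exists (fun x : cdt X * seq (cdt X) => x.1 :: x.2) => //.
exact: computable_cons.
Qed.

Lemma rcomp_foldr T X Y (g : T -> X -> Y -> Y) (f : T -> Y) (l : T -> seq X) :
  rcomp (fun p : T * (X * Y) => g p.1 p.2.1 p.2.2) -> rcomp f -> rcomp l ->
  rcomp (fun t => foldr (g t) (f t) (l t)).
Proof.
move=> [G cG GE] [F cF FE] cl.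
apply: (@rcomp_comp T (pair_coded T (seq_coded X)) Y
  (fun p : T * seq X => foldr (g p.1) (f p.1) p.2) (fun t => (t, l t)));
  last first.
  by apply: rcomp_pair => //; exact: rcomp_id.
exists (fun x : cdt T * seq (cdt X) =>
    foldr (fun a y => G (x.1, (a, y))) (F x.1) x.2).
  exact: (computable_listrec cF cG).
case=> t k /=; rewrite FE; elim: k => //= x k ->.
by rewrite -(GE (t, (x, _))).
Qed.

End RealisedFunctions.

Section CodedBool.

Definition bool_dec (n : tnat) : bool := n != 0.

Lemma bool_encK : cancel nat_of_bool bool_dec. Proof. by case. Qed.

(** Recoding sends 0 to 0 and every positive number to 1: iterate the constant 1, starting from
    0. *)
Lemma bool_dec_computable : @computable tnat tnat (fun c => bool_dec c).
Proof.
have [||F cF FE] := @rcomp_iteri nat_coded nat_coded id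
  (fun _ _ _ => 1) (fun=> 0) (rcomp_id _).
- exact: (rcomp_cst _ (1 : nat_coded)).
- exact: (rcomp_cst _ (0 : nat_coded)).
- by apply: (computable_ext _ cF) => x; rewrite [LHS]FE; case: x.
Qed.

Canonical bool_coded : coded :=
  @Coded bool tnat _ _ bool_encK bool_dec_computable.

End CodedBool.

(** A case distinction is an iteration of length 0 or 1 that overwrites the value of the negative
    branch. *)
Lemma rcomp_if (T X : coded) (b : T -> bool) (f g : T -> X) :
  rcomp b -> rcomp f -> rcomp g -> rcomp (fun t => if b t then f t else g t).
Proof.
move=> [B cB BE] cf cg.
apply: (@rcomp_ext _ _
  (fun t => iteri (nat_of_bool (b t)) (fun _ _ => f t) (g t))).
  by move=> t; case: (b t).
apply: (@rcomp_iteri T X (fun t => nat_of_bool (b t))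
  (fun t _ _ => f t) g) => //.
  by exists B.
apply: (rcomp_comp cf); apply: (@rcomp_fst _ T (pair_coded nat_coded X)).
exact: rcomp_id.
Qed.

Lemma rcomp_negb (T : coded) (f : T -> bool) :
  rcomp f -> rcomp (fun t => ~~ f t).
Proof. by move=> cf; apply: rcomp_if; [|apply: rcomp_cst..]. Qed.

Lemma rcomp_andb (T : coded) (f g : T -> bool) :
  rcomp f -> rcomp g -> rcomp (fun t => f t && g t).
Proof. by move=> cf cg; apply: rcomp_if; [| |apply: rcomp_cst]. Qed.

Lemma rcomp_orb (T : coded) (f g : T -> bool) :
  rcomp f -> rcomp g -> rcomp (fun t => f t || g t).
Proof. by move=> cf cg; apply: rcomp_if; [|apply: rcomp_cst|]. Qed.

Ltac rcomp_basic := lazymatch goal with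
  | |- rcomp (fun t => t) => exact: rcomp_id
  | |- rcomp (@fst _ _) => exact: (rcomp_fst (rcomp_id (pair_coded _ _)))
  | |- rcomp (@snd _ _) => exact: (rcomp_snd (rcomp_id (pair_coded _ _)))
  | |- rcomp (fun t => (@?f t, @?g t)) => refine (@rcomp_pair _ _ _ f g _ _)
  | |- rcomp (fun t => @?f t :: @?g t) => refine (@rcomp_cons _ _ f g _ _)
  | |- rcomp (fun t => (@?f t).1) => refine (@rcomp_fst _ _ _ f _)
  | |- rcomp (fun t => (@?f t).2) => refine (@rcomp_snd _ _ _ f _)
  | |- rcomp (fun t => ~~ (@?f t)) => refine (@rcomp_negb _ f _)
  | |- rcomp (fun t => @?f t && @?g t) => refine (@rcomp_andb _ f g _ _)
  | |- rcomp (fun t => @?f t || @?g t) => refine (@rcomp_orb _ f g _ _)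
  | |- rcomp (fun t => if _ then _ else _) => apply: rcomp_if
  | |- rcomp (fun t => (@?f t).+1) => refine (@rcomp_succ _ f _)
  | |- rcomp (fun t => iteri (@?n t) (@?g t) (@?f t)) =>
      refine (@rcomp_iteri _ _ n g f _ _ _)
  | |- rcomp (fun t => foldr (@?g t) (@?f t) (@?l t)) =>
      refine (@rcomp_foldr _ _ _ g f l _ _ _)
  end; cbv beta.
Ltac rcomp_step := rcomp_basic.
Ltac rcomp_auto := repeat (first [assumption | rcomp_step | exact: rcomp_cst]).

(** The last index seen by an iteration of length [k.+1] is [k]; the step returns its index and
    forgets the rest. *)
Lemma rcomp_pred (T : coded) (f : T -> nat) :
  rcomp f -> rcomp (fun t => (f t).-1).
Proof.
move=> cf; apply: (@rcomp_ext _ _ (fun t => iteri (f t) (fun i _ => i) 0)).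
  by move=> t; case: (f t).
by rcomp_auto.
Qed.

Lemma rcomp_subn (T : coded) (f g : T -> nat) :
  rcomp f -> rcomp g -> rcomp (fun t => f t - g t).
Proof.
move=> cf cg.
apply: (@rcomp_ext _ _ (fun t => iteri (g t) (fun _ y => y.-1) (f t))).
  by move=> t; elim: (g t) => [|k /= ->]; rewrite ?subn0 // subnS.
rcomp_auto; apply: rcomp_pred; rcomp_auto.
Qed.

Lemma rcomp_eq0 (T : coded) (f : T -> nat) :
  rcomp f -> rcomp (fun t => f t == 0).
Proof.
move=> cf.
apply: (@rcomp_ext _ _ (fun t => iteri (f t) (fun _ _ => false) true)).
  by move=> t; case: (f t).
by rcomp_auto.
Qed.

Lemma rcomp_leq (T : coded) (f g : T -> nat) :
  rcomp f -> rcomp g -> rcomp (fun t => f t <= g t).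
Proof. by move=> cf cg; apply: rcomp_eq0; apply: rcomp_subn. Qed.

Lemma rcomp_eqn (T : coded) (f g : T -> nat) :
  rcomp f -> rcomp g -> rcomp (fun t => f t == g t).
Proof.
move=> cf cg; apply: (@rcomp_ext _ _ (fun t => (f t <= g t) && (g t <= f t))).
  by move=> t; rewrite -eqn_leq.
by apply: rcomp_andb; apply: rcomp_leq.
Qed.

Lemma rcomp_cat (T X : coded) (l l' : T -> seq X) :
  rcomp l -> rcomp l' -> rcomp (fun t => l t ++ l' t).
Proof.
move=> cl cl'; apply: (@rcomp_ext _ _ (fun t => foldr cons (l' t) (l t))).
  by move=> t; elim: (l t) => //= x s ->.
by apply: rcomp_foldr; rcomp_auto.
Qed.

Section ListFunctions.
Variable T : coded.
Variables X Y : coded.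
Implicit Types (l : T -> seq X) (a : T -> X -> bool).

Lemma rcomp_size l : rcomp l -> rcomp (fun t => size (l t)).
Proof.
move=> cl; apply: (@rcomp_ext _ _ (fun t => foldr (fun _ k => k.+1) 0 (l t))).
  by move=> t; elim: (l t) => //= x s ->.
by rcomp_auto.
Qed.

Lemma rcomp_map (g : T -> X -> Y) l :
  rcomp (fun p : T * X => g p.1 p.2) -> rcomp l ->
  rcomp (fun t => map (g t) (l t)).
Proof.
move=> cg cl.
apply: (@rcomp_ext _ _ (fun t => foldr (fun x s => g t x :: s) [::] (l t))).
  by move=> t; elim: (l t) => //= x s ->.
apply: rcomp_foldr; rcomp_auto.
by apply: (rcomp_comp cg (f := fun p => (p.1, p.2.1))); rcomp_auto.
Qed.

Lemma rcomp_filter a l :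
  rcomp (fun p : T * X => a p.1 p.2) -> rcomp l ->
  rcomp (fun t => filter (a t) (l t)).
Proof.
move=> ca cl.
apply: (@rcomp_ext _ _
  (fun t => foldr (fun x s => if a t x then x :: s else s) [::] (l t))).
  by move=> t; elim: (l t) => //= x s ->.
apply: rcomp_foldr; rcomp_auto.
by apply: (rcomp_comp ca (f := fun p => (p.1, p.2.1))); rcomp_auto.
Qed.

Lemma rcomp_all a l :
  rcomp (fun p : T * X => a p.1 p.2) -> rcomp l ->
  rcomp (fun t => all (a t) (l t)).
Proof.
move=> ca cl.
apply: (@rcomp_ext _ _ (fun t => foldr (fun x b => a t x && b) true (l t))).
  by move=> t; elim: (l t) => //= x s ->.
apply: rcomp_foldr; rcomp_auto.
by apply: (rcomp_comp ca (f := fun p => (p.1, p.2.1))); rcomp_auto.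
Qed.

Lemma rcomp_flatten (l : T -> seq (seq X)) :
  rcomp l -> rcomp (fun t => flatten (l t)).
Proof.
move=> cl; apply: (@rcomp_ext _ _ (fun t => foldr cat [::] (l t))) => //.
by rcomp_auto; apply: rcomp_cat; rcomp_auto.
Qed.

End ListFunctions.

Lemma rcomp_has (T X : coded) (a : T -> X -> bool) (l : T -> seq X) :
  rcomp (fun p : T * X => a p.1 p.2) -> rcomp l ->
  rcomp (fun t => has (a t) (l t)).
Proof.
move=> ca cl; apply: (@rcomp_ext _ _ (fun t => ~~ all (predC (a t)) (l t))).
  by move=> t; rewrite all_predC negbK.
by apply: rcomp_negb; apply: rcomp_all; rewrite //; apply: rcomp_negb.
Qed.

(** A fold does not see the tail of the list, so the tail is rebuilt next to the truth value. *)
Lemma rcomp_pairwise (T X : coded) (R : T -> X -> X -> bool) (l : T -> seq X) :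
  rcomp (fun p : T * (X * X) => R p.1 p.2.1 p.2.2) -> rcomp l ->
  rcomp (fun t => pairwise (R t) (l t)).
Proof.
move=> cR cl.
apply: (@rcomp_ext _ _ (fun t => (foldr
  (fun x p => (x :: p.1, all (R t x) p.1 && p.2)) ([::], true) (l t)).2)).
  move=> t; suff -> : foldr (fun x p => (x :: p.1, all (R t x) p.1 && p.2))
      ([::], true) (l t) = (l t, pairwise (R t) (l t)) by [].
  by elim: (l t) => //= x s ->.
rcomp_auto; apply: rcomp_all; rcomp_auto.
by apply: (rcomp_comp cR (f := fun p => (p.1.1, (p.1.2.1, p.2)))); rcomp_auto.
Qed.

Ltac rcomp_lists := lazymatch goal with
  | |- rcomp (fun t => @?f t - @?g t) => refine (@rcomp_subn _ f g _ _)
  | |- rcomp (fun t => @?f t <= @?g t) => refine (@rcomp_leq _ f g _ _)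
  | |- rcomp (fun t => size (@?l t)) => refine (@rcomp_size _ _ l _)
  | |- rcomp (fun t => @?f t ++ @?g t) => refine (@rcomp_cat _ _ f g _ _)
  | |- rcomp (fun t => flatten (@?l t)) => refine (@rcomp_flatten _ _ l _)
  | |- rcomp (fun t => map (@?g t) (@?l t)) =>
      refine (@rcomp_map _ _ _ g l _ _)
  | |- rcomp (fun t => filter (@?a t) (@?l t)) =>
      refine (@rcomp_filter _ _ a l _ _)
  | |- rcomp (fun t => all (@?a t) (@?l t)) => refine (@rcomp_all _ _ a l _ _)
  | |- rcomp (fun t => has (@?a t) (@?l t)) => refine (@rcomp_has _ _ a l _ _)
  | |- rcomp (fun t => pairwise (@?a t) (@?l t)) =>
      refine (@rcomp_pairwise _ _ a l _ _)
  end; cbv beta.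
Ltac rcomp_step ::= first [rcomp_basic | rcomp_lists].

(* Decoding a number that codes no letter needs a default letter, hence n.+1. *)
Section CodedOrd.
Variable n : nat.

Definition ord_dec (k : tnat) : 'I_n.+1 := inord (if k <= n then k else 0).

Lemma ord_encK : cancel (fun i : 'I_n.+1 => i : tnat) ord_dec.
Proof. by move=> i; rewrite /ord_dec -ltnS ltn_ord inord_val. Qed.

Lemma ord_dec_computable : @computable tnat tnat (fun c => ord_dec c).
Proof.
have [F cF FE] : rcomp (fun k : nat => if k <= n then k else 0).
  by rcomp_auto; apply: rcomp_leq; rcomp_auto.
apply: (computable_ext _ cF) => x; rewrite [LHS]FE /ord_dec inordK //.
by case: ifP.
Qed.

Canonical ord_coded : coded :=
  @Coded 'I_n.+1 tnat _ _ ord_encK ord_dec_computable.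

End CodedOrd.

(** * Enumeration of all data, the basis of unbounded search *)

Section Enumeration.

Definition unpair_step (p : nat * nat) : nat * nat :=
  if p.1 == 0 then (p.2.+1, 0) else (p.1.-1, p.2.+1).

(* Enumerates the pairs antidiagonal by antidiagonal. *)
Definition unpair (k : nat) : nat * nat :=
  iteri k (fun _ => unpair_step) (0, 0).

Lemma rcomp_unpair : rcomp unpair.
Proof.
apply: rcomp_iteri; [exact: rcomp_id| |exact: rcomp_cst].
rewrite /unpair_step.
rcomp_auto; [apply: rcomp_eq0|apply: rcomp_pred]; rcomp_auto.
Qed.

(** Every pair but the origin has a predecessor: [(a, b.+1)] follows [(a.+1, b)] on its
    antidiagonal, and [(a.+1, 0)] follows [(0, a)], which ends the previous one. Hence the induction
    on the sum and then on [b]. *)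
Lemma unpair_surj a b : exists k, unpair k = (a, b).
Proof.
have [s] := ubnP (a + b); elim: s a b => // s IH a b.
elim: b a => [|b IHb] [|a] abs.
- by exists 0.
- have [k kE] := IH 0 a (ltac:(by rewrite addn0 in abs)).
  by exists k.+1; rewrite /unpair /= -/(unpair k) kE.
- have [|k kE] := IHb 1; first by rewrite addSnnS.
  by exists k.+1; rewrite /unpair /= -/(unpair k) kE.
- have [|k kE] := IHb a.+2; first by rewrite addSnnS.
  by exists k.+1; rewrite /unpair /= -/(unpair k) kE.
Qed.

(** The state holds a number still to be decoded and the part of the list already built, last entry
    first. One step splits the number into the index of the next entry and a remainder. *)
Definition unlist_step X (e : nat -> X) (q : nat * seq X) : nat * seq X :=
  ((unpair q.1).2, e (unpair q.1).1 :: q.2).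

Definition unlist X (e : nat -> X) (k : nat) : seq X :=
  (iteri (unpair k).1 (fun _ => unlist_step e) ((unpair k).2, [::])).2.

Lemma unlist_surj X (e : nat -> X) :
  (forall x, exists k, e k = x) -> forall l, exists k, unlist e k = l.
Proof.
move=> e_surj l.
(* The remainder [c] is kept arbitrary because it has to code the entry that the next step
   prepends. *)
suff H l1 c : exists d,
    iteri (size l1) (fun _ => unlist_step e) (d, [::]) = (c, l1).
  have [d dE] := H l 0; have [k kE] := unpair_surj (size l) d.
  by exists k; rewrite /unlist kE /= dE.
elim: l1 c => [|x l1 IH] c; first by exists c.
have [i iE] := e_surj x; have [j jE] := unpair_surj i c.
have [d dE] := IH j; exists d.
by rewrite /= dE /unlist_step /= jE /= iE.
Qed.

(** Minimisation ranges over numbers only; an enumeration extends it to every type of data. *)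
Lemma dtype_enumerable (t : dtype) :
  exists2 e : nat -> t, @computable tnat t e & forall x, exists k, e k = x.
Proof.
elim: t => [|t1 [e1 c1 s1] t2 [e2 c2 s2]|t [e ce se]].
- by exists id; [exact: computable_id | move=> x; exists x].
- have [F cF FE] := rcomp_unpair.
  exists (fun k => (e1 (F k).1, e2 (F k).2)).
    exact: (computable_comp cF (computable_pair2 c1 c2)).
  case=> x1 x2; have [k1 <-] := s1 x1; have [k2 <-] := s2 x2.
  by have [k kE] := unpair_surj k1 k2; exists k; rewrite [F k]FE kE.
- have re : @rcomp nat_coded (dtype_coded t) e by exists e.
  have [F cF FE] : @rcomp nat_coded (seq_coded (dtype_coded t)) (unlist e).
    have cu (T : coded) (f : T -> nat) :
        rcomp f -> rcomp (fun t => unpair (f t)).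
      exact: (rcomp_comp rcomp_unpair).
    apply: rcomp_snd; apply: rcomp_iteri.
    + by rcomp_auto; apply: cu; rcomp_auto.
    + rewrite /unlist_step; rcomp_auto; first by apply: cu; rcomp_auto.
      by apply: (rcomp_comp re); rcomp_auto; apply: cu; rcomp_auto.
    + by rcomp_auto; apply: cu; rcomp_auto.
  exists (unlist e); last exact: unlist_surj.
  apply: (computable_ext _ cF) => k; rewrite [LHS]FE.
  by rewrite [LHS]map_id.
Qed.

End Enumeration.

(** Regular minimisation along an enumeration of the data that may code an [x]. Decoding turns every
    datum, meaningful or not, into an instance, so existence for all instances yields the totality
    that minimisation demands. *)
Lemma rcomp_search (T X : coded) (P : T -> X -> bool) :
    rcomp (fun p : T * X => P p.1 p.2) -> (forall t, exists x, P t x) ->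
  exists2 f : T -> X, rcomp f & forall t, P t (f t).
Proof.
move=> [F cF FE] exP; have [e ce e_surj] := dtype_enumerable (cdt X).
pose g (p : cdt T * nat) : nat :=
  let t := cdec p.1 in let x := cdec (e p.2) in ~~ P t x.
have g_zero t : exists k, g (t, k) == 0.
  have [x Px] := exP (cdec t); have [k kE] := e_surj (cenc x).
  by exists k; rewrite /g /= kE cencK Px.
have cg : @computable (tprod (cdt T) tnat) tnat g.
  have [N cN NE] : @rcomp bool_coded bool_coded negb.
    exact: (rcomp_negb (rcomp_id _)).
  apply: (@computable_ext (tprod (cdt T) tnat) tnat (fun p =>
    N (F (cenc (cdec p.1), cenc (cdec (e p.2)))))).
    by move=> p /=; rewrite [F _](FE (_, _)) [N _]NE.
  refine (@computable_comp (tprod (cdt T) tnat) tnat tnat _ _ _ cN).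
  refine (@computable_comp (tprod (cdt T) tnat) (tprod (cdt T) (cdt X)) tnat
    _ _ _ cF).
  exact: (@computable_pair2 (cdt T) (cdt T) tnat (cdt X) _ _
    (cdec_computable T) (computable_comp ce (cdec_computable X))).
pose h (t : cdt T) := ex_minn (g_zero t).
have ch : @computable (cdt T) tnat h by exact: computable_mu.
exists (fun t => cdec (e (h (cenc t)))).
  exists (fun t => cenc (cdec (e (h t)) : X)) => //.
  exact: (computable_comp (computable_comp ch ce) (cdec_computable X)).
move=> t; rewrite /h; case: ex_minnP => k.
by rewrite /g /= cencK eqb0 negbK.
Qed.

(** An algorithm may answer yes by any nonzero number; normalising the answer to 0 or 1 makes it a
    realiser of a boolean function. *)
Lemma decided_rcomp (X : coded) (P : X -> Prop) :
  decided_by_algorithm (@cenc X) P <-> rcomp (fun x => `[< P x >]).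
Proof.
split=> [[f cf fE]|[f cf fE]].
  have [N cN NE] := rcomp_negb (rcomp_eq0 (rcomp_id nat_coded)).
  exists (fun x => N (f x)); first exact: (computable_comp cf cN).
  move=> x; rewrite [LHS]NE; congr nat_of_bool.
  by apply/idP/asboolP => [/eqP/fE|/fE/eqP].
exists f => // x; rewrite [f _]fE; split=> [/asboolP -> //|].
by case: asboolP.
Qed.

Local Open Scope group_scope.

(** * Orbits of cyclic subgroups *)

Section Orbits.
Variables (B : groupType) (S : choiceType) (to : right_action B S).
Implicit Types (b c d : B) (x y z s u : S).

(** The two cases stand for exponents of either sign, with natural exponents throughout. *)
Definition same_orbit b x y : Prop :=
  exists k, y = to x (b ^+ k) \/ x = to y (b ^+ k).

Lemma same_orbit_refl b x : same_orbit b x x.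
Proof. by exists 0; left; rewrite expg0 ract1. Qed.

Lemma same_orbit_sym b x y : same_orbit b x y -> same_orbit b y x.
Proof. by case=> k [kE|kE]; exists k; [right|left]. Qed.

Lemma same_orbit_step b x : same_orbit b x (to x b).
Proof. by exists 1%N; left; rewrite expg1. Qed.

Lemma same_orbit_stepV b x : same_orbit b x (to x b^-1).
Proof. by exists 1%N; right; rewrite expg1 ractKV. Qed.

Lemma ract_expD b j k x : to x (b ^+ (j + k)) = to (to x (b ^+ j)) (b ^+ k).
Proof. by rewrite expgnDr ractM. Qed.

Lemma same_orbit_trans b y x z :
  same_orbit b x y -> same_orbit b y z -> same_orbit b x z.
Proof.
have cancel_exp j k u v : j <= k -> to u (b ^+ j) = to v (b ^+ k) ->
    u = to v (b ^+ (k - j)).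
  move=> jk; rewrite -{1}(subnK jk) ract_expD.
  exact: (can_inj (ractK to (b ^+ j))).
move=> [j jE] [k kE]; have [jk|/ltnW jk] := leqP j k.
  case: jE kE => [->|->] [->|kE].
  - by exists (j + k); left; rewrite ract_expD.
  - by exists (k - j); right; apply: cancel_exp.
  - exists (k - j); left; rewrite -{1}(subnKC jk) ract_expD.
    by [].
  - by exists (k + j); right; rewrite kE ract_expD.
case: jE kE => [->|->] [->|kE].
- by exists (j + k); left; rewrite ract_expD.
- by exists (j - k); left; apply: cancel_exp.
- exists (j - k); right; rewrite -{1}(subnKC jk) ract_expD.
  by [].
- by exists (k + j); right; rewrite kE ract_expD.
Qed.

Lemma same_orbit_powers b x y :
  same_orbit b x y <-> exists2 c, powers b c & to x c = y.
Proof.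
split=> [[k [->|->]]|[c [k [->|->]] <-]].
- by exists (b ^+ k) => //; exists k; left.
- by exists (b ^- k); [exists k; right | rewrite ractK].
- by exists k; left.
- by exists k; right; rewrite ractKV.
Qed.

(** An element of the centraliser of [b] permutes the [b]-orbits. *)
Lemma same_orbit_commute b d x y :
  commute b d -> same_orbit b (to x d) (to y d) <-> same_orbit b x y.
Proof.
move=> bd.
have actE k u : to (to u d) (b ^+ k) = to (to u (b ^+ k)) d.
  by rewrite -!ractM (commuteX k (commute_sym bd)).
have toI := can_inj (ractK to d).
by split=> -[k [kE|kE]]; exists k; [left|right|left|right];
  rewrite ?kE ?actE //; apply: toI; rewrite -actE.
Qed.

(** Finiteness is expressed by a positive period; [finite_orbitP] relates it to finiteness of the
    orbit as a set. *)
Definition finite_orbit b x : Prop := exists2 k, 0 < k & to x (b ^+ k) = x.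

Lemma finite_orbit_iota b x k : 0 < k -> to x (b ^+ k) = x ->
  forall y, same_orbit b x y -> exists2 i, i < k & y = to x (b ^+ i).
Proof.
move=> k0 kE; have periodic j : to x (b ^+ (j * k)) = x.
  by elim: j => [|j IH]; rewrite ?expg0 ?ract1 // mulSn ract_expD kE.
have modE j : to x (b ^+ j) = to x (b ^+ (j %% k)).
  by rewrite [in LHS](divn_eq j k) ract_expD periodic.
move=> y [j [->|jE]]; first by exists (j %% k); rewrite ?ltn_mod.
(* As [j * k] is a period, [j] steps backwards amount to [j * k.-1] steps forwards. *)
have -> : y = to x (b ^+ (j * k.-1)).
  rewrite -[LHS](ractK to (b ^+ j)) -jE -{1}(periodic j) -{1}(prednK k0) mulnS.
  by rewrite addnC ract_expD ractK.
by exists ((j * k.-1) %% k); rewrite ?ltn_mod // -modE.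
Qed.

(** Pigeonhole: if the first [(size r).+1] forward points all lay in [r], two would coincide and
    give a period. Applied to a finite support, this finds a point of the orbit where a function is
    trivial. *)
Lemma infinite_orbit_avoid b x (r : seq S) :
  ~ finite_orbit b x -> exists j, to x (b ^+ j) \notin r.
Proof.
move=> inf; apply: contrapT => in_r.
have sub : {subset [seq to x (b ^+ i) | i <- iota 0 (size r).+1] <= r}.
  move=> y /mapP[i _ ->]; apply/negPn/negP => yr; apply: in_r; by exists i.
suff un : uniq [seq to x (b ^+ i) | i <- iota 0 (size r).+1].
  by have := uniq_leq_size un sub; rewrite size_map size_iota ltnn.
rewrite map_inj_uniq ?iota_uniq // => i j.
wlog ij : i j / i <= j => [W|] e.
  by case/orP: (leq_total i j) => /W; [apply|move->].
apply/eqP; rewrite eqn_leq ij /= leqNgt; apply/negP => ltij; apply: inf.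
exists (j - i); first by rewrite subn_gt0.
apply: (can_inj (ractK to (b ^+ i))).
by rewrite -ract_expD subnK.
Qed.

Lemma finite_orbitP b x :
  finite_set (image (powers b) (to x)) <-> finite_orbit b x.
Proof.
split=> [/finite_seqP[r rE]|[k k0 kE]].
  apply: contrapT => /(infinite_orbit_avoid r)[j /negP]; apply.
  suff : image (powers b) (to x) (to x (b ^+ j)) by rewrite rE.
  by exists (b ^+ j) => //; exists j; left.
apply/finite_seqP; exists [seq y <- [seq to x (b ^+ i) | i <- iota 0 k]
  | `[< same_orbit b x y >]].
apply/seteqP; split=> y /=.
  move=> [c bc <-]; have xc : same_orbit b x (to x c).
    by apply/same_orbit_powers; exists c.
  rewrite mem_filter; apply/andP; split; first exact/asboolP.
  have [i ik ->] := finite_orbit_iota k0 kE xc.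
  by apply/mapP; exists i; rewrite // mem_iota.
by rewrite mem_filter => /andP[/asboolP/same_orbit_powers[c bc <-] _]; exists c.
Qed.

Lemma finite_orbit_trans b x y :
  same_orbit b x y -> finite_orbit b x -> finite_orbit b y.
Proof.
move=> xy [k k0 kE]; exists k => //.
have [i _ ->] := finite_orbit_iota k0 kE xy.
by rewrite -ract_expD addnC ract_expD kE.
Qed.

Lemma finite_orbit_commute b d x :
  commute b d -> finite_orbit b x -> finite_orbit b (to x d).
Proof.
move=> bd [k k0 kE]; exists k => //.
by rewrite -ractM (commuteX k (commute_sym bd)) ractM kE.
Qed.

End Orbits.

(** * Conjugacy along an orbit *)

Section LocalConjugacy.
Variables (A B : groupType) (S : choiceType) (to : right_action B S).
Variable b : B.
Implicit Types (x y z s u : S) (p q r : A) (O : S -> Prop).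
Implicit Types (f g h : {fsfun S -> A with 1}).

(* On the wreath product, [loc_conj (fun=> True) f g] says that (1, h)
   conjugates (b, f) to (b, g) for some h. *)
Definition loc_conj O f g : Prop :=
  exists h : {fsfun S -> A with 1},
    forall u, O u -> f u * h u = h (to u b^-1) * g u.

Local Notation "f ~[ O ] g" := (loc_conj O f g)
  (at level 70, format "f  ~[ O ]  g").

Lemma loc_conj_eq O f g : (forall u, O u -> f u = g u) -> f ~[O] g.
Proof.
by move=> fg; exists [fsfun with 1] => u /fg; rewrite !fsfun0E mulg1 mul1g.
Qed.

Lemma loc_conj_sym O f g : f ~[O] g -> g ~[O] f.
Proof.
move=> [h hP]; exists (fs_inv h) => u /hP hu; rewrite !fs_invE.
by apply: (mulgI (h (to u b^-1))); rewrite mulVKg mulgA -hu mulgK.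
Qed.

Lemma loc_conj_trans O g f k : f ~[O] g -> g ~[O] k -> f ~[O] k.
Proof.
move=> [h hP] [h' h'P]; exists (fs_mul h h') => u Ou.
by rewrite !fs_mulE mulgA hP // -mulgA h'P // mulgA.
Qed.

Lemma loc_conj_sub O O' f g :
  (forall u, O' u -> O u) -> f ~[O] g -> f ~[O'] g.
Proof. by move=> sub [h hP]; exists h => u /sub/hP. Qed.

Lemma ractV_eq u x : (to u b^-1 == x) = (u == to x b).
Proof. by apply/eqP/eqP => [<-|->]; rewrite ?ractKV ?ractK. Qed.

Lemma loc_conj_step O x p : fs_single x p ~[O] fs_single (to x b) p.
Proof.
have [->|xb] := eqVneq (to x b) x; first exact: loc_conj_eq.
(* The value [p^-1] cancels [p] at [x]; seen from [to x b] it is the value one step back, where it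
   has to be compensated by [p]. *)
exists (fs_single x p^-1) => u _; rewrite !fs_singleE ractV_eq.
case: (eqVneq u x) => [->|_]; first by rewrite eq_sym (negPf xb) mulgV mulg1.
by case: eqP => _; rewrite ?mulVg mulg1.
Qed.

Lemma loc_conj_move O x y p :
  same_orbit to b x y -> fs_single x p ~[O] fs_single y p.
Proof.
have mv k u : fs_single u p ~[O] fs_single (to u (b ^+ k)) p.
  elim: k => [|k IH]; first by rewrite expg0 ract1; apply: loc_conj_eq.
  by apply: loc_conj_trans IH _; rewrite expgSr ractM; apply: loc_conj_step.
by case=> k [->|->]; [|apply: loc_conj_sym]; apply: mv.
Qed.

(** A function that is constantly [a] on the orbit conjugates by [a]; its support is finite because
    the orbit is. *)
Lemma loc_conj_finite x p a : finite_orbit to b x ->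
  fs_single x p ~[same_orbit to b x] fs_single x (p ^ a).
Proof.
move=> [k k0 kE].
pose h : {fsfun S -> A with 1} :=
  [fsfun u in [fset to x (b ^+ i) | i in iota 0 k]%fset => a | 1].
have hE u : same_orbit to b x u -> h u = a.
  move=> /(finite_orbit_iota k0 kE)[i ik ->]; rewrite fsfunE ifT //.
  by apply/imfsetP; exists i; rewrite //= mem_iota.
exists h => u xu; have xu' := same_orbit_trans xu (same_orbit_stepV to b u).
rewrite !hE // !fs_singleE.
by case: eqP => _; rewrite ?conjgE ?mulVKg ?mul1g ?mulg1.
Qed.

(** The conjugating function [h] is constant along the orbit except across the step into [x], where
    [p * h x = h (to x b^-1) * r]. On a finite orbit, going round once shows that these two values
    of [h] agree. On an infinite orbit both are 1, since [h] is constant forwards from [x] and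
    backwards from [to x b^-1] and has finite support. *)
Lemma loc_conj_single x p r :
    fs_single x p ~[same_orbit to b x] fs_single x r ->
  conjugate p r /\ (~ finite_orbit to b x -> p = r).
Proof.
move=> [h hP].
have hx : p * h x = h (to x b^-1) * r.
  by have := hP x (same_orbit_refl _ _ _); rewrite !fs_singleE eqxx.
have hN u : same_orbit to b x u -> u != x -> h u = h (to u b^-1).
  move=> xu /negPf ux; have := hP u xu.
  by rewrite !fs_singleE ux mul1g mulg1.
have [[k k0 kE]|inf] := pselect (finite_orbit to b x).
  split; last by case; exists k.
  (* The least period is taken, so that the points strictly between two visits to [x] differ from
     [x]. *)
  pose k' := ex_minn (ex_intro (fun k => (0 < k) && (to x (b ^+ k) == x)) k
    (introT andP (conj k0 (introT eqP kE)))).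
  have [k'0 k'E k'min] : [/\ 0 < k', to x (b ^+ k') = x &
      forall j, 0 < j < k' -> to x (b ^+ j) != x].
    rewrite /k'; case: ex_minnP => j /andP[j0 /eqP jE] jmin; split=> // i.
    move=> /andP[i0]; apply: contraTN => iE; rewrite -leqNgt.
    by apply: jmin; rewrite i0.
  have hE j : j < k' -> h (to x (b ^+ j)) = h x.
    elim: j => [|j IH] jk; first by rewrite expg0 ract1.
    rewrite hN ?k'min ?jk //; last by exists j.+1; left.
    by rewrite expgSr ractM ractK IH // ltnW.
  exists (h x); rewrite conjgE hx -(hE k'.-1) ?prednK //.
  have -> : to x (b ^+ k'.-1) = to x b^-1.
    by rewrite -{2}k'E -{2}(prednK k'0) expgSr ractM ractK.
  by rewrite mulKg.
have hpos j : h (to x (b ^+ j)) = h x.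
  elim: j => [|j IH]; first by rewrite expg0 ract1.
  rewrite hN; first by rewrite expgSr ractM ractK.
    by exists j.+1; left.
  by apply/eqP => e; apply: inf; exists j.+1.
have xVb j : to (to x b^-1) (b ^- j) = to x (b ^- j.+1).
  by rewrite -ractM expgSr invgM.
have hneg j : h (to x b^-1) = h (to x (b ^- j.+1)).
  elim: j => [|j IH]; first by rewrite expg1.
  rewrite IH hN; first by rewrite -ractM -invgM -expgS.
    by exists j.+1; right; rewrite ractKV.
  apply/eqP => e; apply: inf; exists j.+1 => //.
  by rewrite -[in RHS](ractKV to (b ^+ j.+1) x) e.
(* The backward half of the orbit is treated as a forward orbit of [b^-1]. *)
have infV : ~ finite_orbit to b^-1 x.
  move=> [k k0 kE]; apply: inf; exists k => //.
  by rewrite -[in LHS]kE expVgn ractKV.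
have h1 : h x = 1.
  have [j jN] := infinite_orbit_avoid (finsupp h) inf.
  by rewrite -(hpos j) fsfun_dflt.
have hb1 : h (to x b^-1) = 1.
  have infV' : ~ finite_orbit to b^-1 (to x b^-1).
    move=> H; apply: infV; apply: (finite_orbit_trans _ H).
    by apply: same_orbit_sym; apply: same_orbit_step.
  have [j jN] := infinite_orbit_avoid (finsupp h) infV'.
  by rewrite (hneg j) -xVb -expVgn fsfun_dflt.
have pr : p = r by rewrite h1 hb1 mulg1 mul1g in hx.
by split=> //; exists 1; rewrite conjg1.
Qed.

(** The condition at [u] involves only [u] and [to u b^-1], which share an orbit, so solutions
    chosen orbit by orbit fit together. Finite support is kept by using them only on the finitely
    many orbits that meet the support of [f] or [g]. *)
Lemma loc_conj_glue f g :
  (forall s, f ~[same_orbit to b s] g) -> f ~[fun=> True] g.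
Proof.
move=> loc.
have /choice[H HP] : forall s, exists h : {fsfun S -> A with 1},
    forall u, same_orbit to b s u -> f u * h u = h (to u b^-1) * g u.
  exact: loc.
(* Canonical choice yields one representative per orbit, so that the same local solution is used
   along the whole orbit. *)
pose rep s := choose (fun y => `[< same_orbit to b s y >]) s.
have repP s : same_orbit to b s (rep s).
  apply/asboolP; apply: (@chooseP _ (fun y => `[< same_orbit to b s y >])).
  by apply/asboolP; apply: same_orbit_refl.
have repE s u : same_orbit to b s u -> rep s = rep u.
  move=> su; rewrite /rep.
  have E : (fun y => `[< same_orbit to b s y >]) =1
           (fun y => `[< same_orbit to b u y >]).
    move=> y; apply/asboolP/asboolP; apply: same_orbit_trans => //.
    exact: same_orbit_sym.
  rewrite (eq_choose E); apply: choose_id; apply/asboolP.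
    exact: same_orbit_sym.
  exact: same_orbit_refl.
pose T := (finsupp f `|` finsupp g)%fset.
pose meets u := `[< exists2 s, s \in T & same_orbit to b s u >].
pose h : {fsfun S -> A with 1} :=
  [fsfun u in (\bigcup_(s <- T) finsupp (H (rep s)))%fset =>
     if meets u then H (rep u) u else 1 | 1].
have hE u : h u = if meets u then H (rep u) u else 1.
  rewrite fsfunE; case: ifPn => //; case: ifPn => // /asboolP[s sT su] uN.
  rewrite fsfun_dflt //; apply: contra uN => uH.
  by apply/bigfcupP; exists s; rewrite ?sT // (repE _ _ su).
exists h => u _; rewrite !hE.
have uu' := same_orbit_stepV to b u.
have -> : meets (to u b^-1) = meets u.
  apply/asboolP/asboolP => -[s sT su]; exists s => //.
    exact: same_orbit_trans su (same_orbit_sym uu').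
  exact: same_orbit_trans su uu'.
rewrite -(repE _ _ uu'); case: ifPn => [_|/asboolP um].
  by apply: HP; apply/same_orbit_sym/repP.
have uT : u \notin T.
  by apply/negP => uT; apply: um; exists u; last exact: same_orbit_refl.
by move: uT; rewrite in_fsetU negb_or => /andP[uf ug]; rewrite !fsfun_dflt.
Qed.

Definition reduced_support f : Prop :=
  forall x y, f x != 1 -> f y != 1 -> same_orbit to b x y -> x = y.

(* Sliding the value at x by one step either merges it with another value or
   brings it closer to y without changing the size of the support. *)
Lemma loc_conj_shrink k f x y :
    x != y -> f x != 1 -> f y != 1 -> y = to x (b ^+ k) ->
  exists2 g, f ~[fun=> True] g & #|` finsupp g| < #|` finsupp f|.
Proof.
elim: k f x => [|k IH] f x xy fx fy yE.
  by rewrite yE expg0 ract1 eqxx in xy.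
(* Otherwise [x] would be a fixed point of [b], and [y] would equal [x]. *)
have xbx : to x b != x.
  apply: contra_neqN xy => /eqP xb; rewrite yE.
  by elim: k.+1 => [|j jE]; rewrite ?expg0 ?ract1 // expgS ractM xb.
(* With this [h], the conjugate [g] is 1 at [x] and the value [f x] is multiplied from the left onto
   the value at [to x b]. *)
pose h := fs_single x (f x)^-1.
pose g := fs_mul (fs_mul (fs_shift to (fs_inv h) b) f) h.
have gE u : g u = if u == x then 1 else if u == to x b then f x * f u else f u.
  rewrite /g !(fs_mulE, fs_shiftE, fs_invE, fs_singleE) ractV_eq.
  case: (eqVneq u x) => [->|_].
    by rewrite eq_sym (negPf xbx) invg1 mul1g mulgV.
  by case: ifP => _; rewrite ?invgK ?invg1 mulg1 ?mul1g.
have fg : f ~[fun=> True] g.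
  exists h => u _; rewrite /g !(fs_mulE, fs_shiftE, fs_invE) !mulgA.
  by rewrite mulgV mul1g.
have [fxb|fxb] := boolP (f (to x b) == 1).
  have xb_y : to x b != y by apply: contraNneq fy => <-.
  have gy : g y != 1.
    by rewrite gE (eq_sym y x) (negPf xy) (eq_sym y) (negPf xb_y).
  have gxb : g (to x b) != 1.
    by rewrite gE (negPf xbx) eqxx (eqP fxb) mulg1.
  have yE' : y = to (to x b) (b ^+ k) by rewrite -ractM -expgS.
  have [g' gg' lt] := IH g (to x b) xb_y gxb gy yE'.
  exists g'; first exact: loc_conj_trans fg gg'.
  apply: leq_trans lt _.
  have -> : #|` finsupp f| = #|` (to x b) |` (finsupp f `\ x)|%fset.
    rewrite cardfsU1 [#|` finsupp f|](cardfsD1 x) in_fsetD1 !mem_finsupp.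
    by rewrite (negPf xbx) fx fxb.
  apply: fsubset_leq_card; apply/fsubsetP => u.
  rewrite mem_finsupp gE in_fset1U in_fsetD1 mem_finsupp.
  case: (eqVneq u x) => [_|_]; first by rewrite eqxx.
  by case: (eqVneq u (to x b)).
(* The point [to x b] was already in the support, which therefore loses [x] and gains nothing; the
   merged value may even be trivial. *)
exists g => //.
rewrite [X in _ < X](cardfsD1 x) mem_finsupp fx ltnS.
apply: fsubset_leq_card; apply/fsubsetP => u.
rewrite mem_finsupp gE in_fsetD1 mem_finsupp.
case: (eqVneq u x) => [_|_]; first by rewrite eqxx.
by case: (eqVneq u (to x b)) => [->|].
Qed.

(** Descent on the size of the support: two support points on one orbit always allow it to
    shrink. *)
Lemma loc_conj_reduce f :
  exists2 g, f ~[fun=> True] g & reduced_support g.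
Proof.
have [k] := ubnP #|` finsupp f|; elim: k f => // k IH f fk.
have [red|nred] := pselect (reduced_support f).
  by exists f => //; apply: loc_conj_eq.
have [g fg lt] : exists2 g, f ~[fun=> True] g & #|` finsupp g| < #|` finsupp f|.
  apply: contrapT => no; apply: nred => x y fx fy [j jE].
  apply/eqP/negPn/negP => xy; apply: no.
  by case: jE => jE; apply: loc_conj_shrink jE => //; rewrite eq_sym.
have [|g' gg' red] := IH g; first exact: leq_trans lt _.
by exists g' => //; apply: loc_conj_trans fg gg'.
Qed.

End LocalConjugacy.

(** For a conjugator [(d, h)], the identity [(b, f)(d, h) = (d, h)(c, g)] splits into [b d = d c]
    and [f^d h = h^c g]. *)
Lemma conjugate_wreath (A B : groupType) (S : choiceType)
    (to : right_action B S) b c (f g : {fsfun S -> A with 1}) :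
  conjugate (Wreath to b f) (Wreath to c g) <->
  exists2 d, b * d = d * c & loc_conj to c (fun=> True) (fs_shift to f d) g.
Proof.
have conjP : conjugate (Wreath to b f) (Wreath to c g) <->
    exists z, Wreath to b f * z = z * Wreath to c g.
  split=> -[z zE]; exists z; first by rewrite -zE conjgE mulVKg.
  by rewrite conjgE zE mulKg.
split=> [/conjP[[d h] [e1 e2]]|[d e1 [h hP]]].
  exists d => //; exists h => u _; have /fsfunP/(_ u) := e2.
  by rewrite !fs_mulE !fs_shiftE.
apply/conjP; exists (Wreath to d h); congr Wreath => //.
by apply/fsfunP => u; rewrite /= !fs_mulE hP // !fs_shiftE.
Qed.

(** * Conjugacy of normal forms *)

(** All graphs of assignments from [l] to [k] that respect [R], injective or not; an empty [l] has
    exactly one, the empty graph. *)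
Definition matchings (X Y : Type) (R : X -> Y -> bool) (l : seq X)
    (k : seq Y) : seq (seq (X * Y)) :=
  foldr (fun x cs =>
    flatten [seq [seq (x, y) :: c | c <- cs] | y <- [seq y <- k | R x y]])
    [:: [::]] l.

Section Matchings.
Variables X Y : eqType.
Implicit Types (l : seq X) (k : seq Y).

(** No two entries of [l] share a partner, so the assignment is injective; the induction removes the
    partner of the head from [k]. *)
Lemma leq_size_matching (R : X -> Y -> Prop) l k :
    {in l, forall x, exists2 y, y \in k & R x y} ->
    pairwise (fun x x' => ~~ `[< exists2 y, R x y & R x' y >]) l ->
  size l <= size k.
Proof.
elim: l k => //= x l IH k ex /andP[/allP xl pw].
have [y yk xy] := ex x (mem_head _ _).
have := IH (rem y k); rewrite size_rem //; case: k ex yk => // y0 k ex yk.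
apply=> // x' x'l; have [|y' y'k x'y'] := ex x'; first by rewrite inE x'l orbT.
exists y' => //; apply: rem_mem y'k; apply/eqP => y'y.
by have /asboolP[] := xl x' x'l; exists y; rewrite // -y'y.
Qed.

(** The candidates depend on [R] alone. When [Q] involves an unknown element [d], this allows the
    finite choice of an assignment to be made before [d] is sought. *)
Lemma matchingsP (R : X -> Y -> bool) (Q : X -> Y -> Prop) l k :
  {in l, forall x, exists2 y, y \in k & R x y /\ Q x y} <->
  exists2 c, c \in matchings R l k & {in c, forall p, Q p.1 p.2}.
Proof.
elim: l => [|x l IH]; first by split=> // _; exists [::].
split=> [ex|[c /flatten_mapP[y]]].
  have [y yk [Rxy Qxy]] := ex x (mem_head _ _).
  have [|c cP cQ] := IH.1.
    by move=> x' x'l; apply: ex; rewrite inE x'l orbT.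
  exists ((x, y) :: c).
    apply/flatten_mapP; exists y; first by rewrite mem_filter Rxy.
    by apply/mapP; exists c.
  by move=> p; rewrite inE => /predU1P[->|/cQ].
rewrite mem_filter => /andP[Rxy yk] /mapP[c' c'P ->] cQ x'.
rewrite inE => /predU1P[->|x'l].
  by exists y => //; split=> //; apply: (cQ (x, y)); rewrite mem_head.
apply: IH.2 x' x'l; exists c' => // p pc'; apply: cQ.
by rewrite inE pc' orbT.
Qed.

End Matchings.

(** * Finitely supported functions given by lists, and the conjugacy criterion *)

Section ReducedLists.
Variables (A B : groupType) (S : choiceType) (to : right_action B S) (s0 : S).
Variables (m n : nat) (gA : 'I_m -> A) (gB : 'I_n -> B).

Local Notation wA := (word m).
Local Notation wB := (word n).
Local Notation evA := (eval_word gA).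
Local Notation evB := (eval_word gB).
Local Notation pt t := (to s0 (evB t)).
Local Notation orb := (same_orbit to).

Implicit Types (L : seq (wB * wA)) (b d : B) (s u : S).

(** Values listed at the same point are multiplied in the order of the list, so every list denotes a
    function, reduced or not. *)
Definition list_fun L : {fsfun S -> A with 1} :=
  foldr (fun q f => fs_mul (fs_single (pt q.1) (evA q.2)) f) [fsfun with 1] L.

Lemma list_fun_cons q L u :
  list_fun (q :: L) u = (if u == pt q.1 then evA q.2 else 1) * list_fun L u.
Proof. by rewrite /= fs_mulE fs_singleE. Qed.

Definition reduced_list b L : bool :=
  all (fun q => evA q.2 != 1) L &&
  pairwise (fun q r => ~~ `[< orb b (pt q.1) (pt r.1) >]) L.

Lemma list_fun_off b s L : {in L, forall q, ~ orb b s (pt q.1)} ->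
  forall u, orb b s u -> list_fun L u = 1.
Proof.
elim: L => [|q L IH] off u su; first by rewrite fsfun0E.
rewrite list_fun_cons IH //; last first.
  by move=> r rL; apply: off; rewrite inE rL orbT.
case: eqP => [uq|_]; last by rewrite mulg1.
by case: (off q (mem_head _ _)); rewrite -uq.
Qed.

Lemma list_fun_reduced b L q : reduced_list b L -> q \in L ->
  forall u, orb b (pt q.1) u -> list_fun L u = fs_single (pt q.1) (evA q.2) u.
Proof.
rewrite /reduced_list.
elim: L => //= r L IH /andP[/andP[r1 L1] /andP[/allP rL pw]].
rewrite inE => /predU1P[->|qL] u qu; rewrite list_fun_cons fs_singleE.
  rewrite (list_fun_off _ qu) ?mulg1 // => q' q'L.
  exact/asboolPn/rL.
rewrite IH ?L1 // fs_singleE.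
case: eqP => [ur|_]; last by rewrite mul1g.
have /asboolP[] := rL q qL.
by apply: same_orbit_sym; rewrite -ur.
Qed.

Hypothesis to_transitive : transitive_action to.
Hypothesis genA : forall x : A, exists w, evA w = x.
Hypothesis genB : forall x : B, exists w, evB w = x.

Lemma reduced_list_exists b (f : {fsfun S -> A with 1}) :
  reduced_support to b f -> exists2 L, list_fun L = f & reduced_list b L.
Proof.
move=> red.
have /choice[wS wSE] : forall s, exists t, pt t = s.
  move=> s; have [x <-] := to_transitive s0 s; have [t <-] := genB x.
  by exists t.
have /choice[wf wfE] : forall s, exists p, evA p = f s by move=> s; apply: genA.
exists [seq (wS s, wf s) | s <- finsupp f].
  apply/fsfunP => u.
  have H (r : seq S) : uniq r ->
      list_fun [seq (wS s, wf s) | s <- r] u = if u \in r then f u else 1.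
    elim: r => [|s r IH] /=; first by rewrite fsfun0E.
    move=> /andP[sr ur]; rewrite fs_mulE fs_singleE wSE wfE IH // inE.
    case: eqP => [->|_]; last by rewrite mul1g.
    by rewrite (negPf sr) mulg1.
  by rewrite H ?fset_uniq //; case: ifPn => // uf; rewrite fsfun_dflt.
apply/andP; split.
  by apply/allP => _ /mapP[s sf ->] /=; rewrite wfE -mem_finsupp.
rewrite pairwise_map.
apply: (@sub_in_pairwise _ (mem (finsupp f)) [rel x y | x != y]).
- move=> x y; rewrite !mem_finsupp /= !wSE => fx fy.
  by apply: contra => /asboolP/(red _ _ fx fy) ->.
- exact/allP.
- by rewrite -uniq_pairwise fset_uniq.
Qed.

(* For abelian A the second clause follows from the first, so that finiteness of
   orbits need not be decided. *)
Definition matching b (q r : wB * wA) : Prop :=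
  conjugate (evA q.2) (evA r.2) /\
  (finite_orbit to b (pt q.1) \/ evA q.2 = evA r.2).

Section Criterion.
Variables (b : B) (L1 L2 : seq (wB * wA)).
Hypothesis (red1 : reduced_list b L1) (red2 : reduced_list b L2).

Lemma list_fun_shift d q : commute b d -> q \in L1 ->
  forall u, orb b (to (pt q.1) d) u ->
  fs_shift to (list_fun L1) d u = fs_single (to (pt q.1) d) (evA q.2) u.
Proof.
move=> bd qL u; rewrite -{1}(ractKV to d u) same_orbit_commute //.
rewrite fs_shiftE => /(list_fun_reduced red1 qL) ->.
by rewrite !fs_singleE ractV_eq.
Qed.

(** On the orbit of the translated point [x], the left function is a single value. If [L2] has an
    entry there, its value is slid to [x] and [loc_conj_single] compares the two. If not, the value
    of [q] is conjugate to 1, which a reduced list excludes. *)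
Lemma conjugate_matching d : commute b d ->
    loc_conj to b (fun=> True) (fs_shift to (list_fun L1) d) (list_fun L2) ->
  {in L1, forall q, exists2 r, r \in L2 &
    matching b q r /\ orb b (to (pt q.1) d) (pt r.1)}.
Proof.
move=> bd loc q qL; set x := to (pt q.1) d.
have {}loc : loc_conj to b (orb b x) (fs_single x (evA q.2)) (list_fun L2).
  apply: loc_conj_trans (loc_conj_sub _ loc) => //.
  apply: loc_conj_sym; apply: loc_conj_eq; exact: list_fun_shift.
have [[r rL xr]|no] := pselect (exists2 r, r \in L2 & orb b x (pt r.1)).
  have /loc_conj_single[cj eq_inf] :
      loc_conj to b (orb b x) (fs_single x (evA q.2)) (fs_single x (evA r.2)).
    apply: (loc_conj_trans (g := list_fun L2)) => //.
    apply: (loc_conj_trans (g := fs_single (pt r.1) (evA r.2))).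
      apply: loc_conj_eq => u xu; apply: (list_fun_reduced red2 rL).
      exact: same_orbit_trans (same_orbit_sym xr) xu.
    by apply: loc_conj_move; apply: same_orbit_sym.
  exists r => //; split=> //; split=> //.
  have [fin|inf] := pselect (finite_orbit to b x); last by right; apply: eq_inf.
  left; rewrite -(ractK to d (pt q.1)); apply: finite_orbit_commute fin.
  exact: commuteV.
have /loc_conj_single[[z zE] _] :
    loc_conj to b (orb b x) (fs_single x (evA q.2)) (fs_single x 1).
  apply: (loc_conj_trans loc); apply: loc_conj_eq => u xu.
  rewrite fs_singleE if_same; apply: list_fun_off xu => r rL xr.
  by apply: no; exists r.
have /andP[/allP/(_ q qL)/negP q1 _] := red1.
by case: q1; rewrite -(conjg_eq1 _ z) zE.
Qed.

Lemma orbit_pairwise d : commute b d ->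
  pairwise (fun q q' => ~~ `[< exists2 r : wB * wA,
      orb b (to (pt q.1) d) (pt r.1) & orb b (to (pt q'.1) d) (pt r.1) >]) L1.
Proof.
move=> bd; have /andP[_] := red1; apply: sub_pairwise => q q'.
apply: contra => /asboolP[r qr q'r]; apply/asboolP.
apply/(same_orbit_commute _ _ _ bd).
exact: same_orbit_trans qr (same_orbit_sym q'r).
Qed.

Lemma conjugate_leq_size :
    conjugate (Wreath to b (list_fun L1)) (Wreath to b (list_fun L2)) ->
  size L1 <= size L2.
Proof.
move=> /conjugate_wreath[d bd loc].
apply: leq_size_matching (orbit_pairwise bd) => q qL.
by have [r rL [_ qr]] := conjugate_matching bd loc qL; exists r.
Qed.

(** The conjugation is built on each orbit separately. On an orbit hit by a translated entry of
    [L1], the value is first conjugated, if the orbit is finite, and then slid to the matching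
    entry. On all other orbits both functions are trivial. *)
Lemma matching_conjugate d : commute b d -> size L1 = size L2 ->
    {in L1, forall q, exists2 r, r \in L2 &
      matching b q r /\ orb b (to (pt q.1) d) (pt r.1)} ->
  conjugate (Wreath to b (list_fun L1)) (Wreath to b (list_fun L2)).
Proof.
move=> bd sizeE ex; apply/conjugate_wreath; exists d => //.
apply: loc_conj_glue => s.
have [[q qL sq]|no] := pselect (exists2 q, q \in L1 & orb b s (to (pt q.1) d)).
  have [r rL [[[z zE] fin_eq] qr]] := ex q qL.
  set x := to (pt q.1) d in sq qr *.
  have qs u : orb b s u -> orb b x u.
    exact: same_orbit_trans (same_orbit_sym sq).
  apply: (loc_conj_sub (O := orb b x)) => //.
  apply: (loc_conj_trans (g := fs_single x (evA q.2))).
    by apply: loc_conj_eq; apply: list_fun_shift.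
  apply: (loc_conj_trans (g := fs_single x (evA r.2))).
    case: fin_eq => [fin|->]; last exact: loc_conj_eq.
    by rewrite -zE; apply: loc_conj_finite; apply: finite_orbit_commute.
  apply: (loc_conj_trans (g := fs_single (pt r.1) (evA r.2))).
    exact: loc_conj_move.
  apply: loc_conj_eq => u xu; apply/esym/(list_fun_reduced red2 rL).
  exact: same_orbit_trans (same_orbit_sym qr) xu.
apply: loc_conj_eq => u su.
rewrite fs_shiftE (list_fun_off (b := b) (s := to s d^-1)); first last.
- by apply/(same_orbit_commute _ _ _ (commuteV bd)).
- move=> q qL sq; apply: no; exists q => //; rewrite -(ractKV to d s).
  exact/(same_orbit_commute _ _ _ bd).
apply/esym/(list_fun_off _ su) => r rL sr.
(* An entry [r] of [L2] on an orbit that no entry of [L1] reaches would leave an injection of [L1]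
   into the rest of [L2], against the equality of sizes. *)
suff: size L1 <= size (rem r L2).
  by rewrite size_rem // sizeE; case: L2 rL => //= a L _; rewrite ltnn.
apply: leq_size_matching (orbit_pairwise bd) => q qL.
have [r' r'L [_ qr']] := ex q qL; exists r' => //.
apply: rem_mem r'L; apply/eqP => r'r; apply: no; exists q => //.
by apply: same_orbit_trans sr _; rewrite -r'r; apply: same_orbit_sym.
Qed.

End Criterion.

Lemma conjugate_reduced b L1 L2 : reduced_list b L1 -> reduced_list b L2 ->
  conjugate (Wreath to b (list_fun L1)) (Wreath to b (list_fun L2)) <->
  size L1 = size L2 /\ exists2 d, commute b d &
    {in L1, forall q, exists2 r, r \in L2 &
      matching b q r /\ orb b (to (pt q.1) d) (pt r.1)}.
Proof.
move=> red1 red2; split=> [cj|[sizeE [d bd ex]]]; last first.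
  exact: matching_conjugate ex.
split; last first.
  have /conjugate_wreath[d bd loc] := cj.
  by exists d => //; apply: conjugate_matching.
apply/eqP; rewrite eqn_leq; apply/andP.
split; apply: (@conjugate_leq_size b) => //.
by have [z <-] := cj; exists z^-1; rewrite conjgK.
Qed.

(** Under the identification of [S] with right cosets, the double coset is the set of elements
    taking [s0] into the [b]-orbit of [to s0 c]. The membership problem thus decides whether two
    points share an orbit. *)
Lemma double_coset_orbit c b x :
  image2 (stabiliser to s0) (powers b) (fun h y => h * c * y) x <->
  orb b (to s0 c) (to s0 x).
Proof.
rewrite same_orbit_powers; split=> [[h hH [y yb <-]]|[y yb yE]].
  by exists y => //; rewrite !ractM hH.
exists (x * y^-1 * c^-1).
  by rewrite /stabiliser /= !ractM -yE !ractK.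
by exists y => //; rewrite !mulgVK.
Qed.

(** An element [d] lies in the set given by [q] exactly when [evB q.1 * d] lies in the double coset
    of [evB q.2], that is, when [d] carries the orbit of the first point to that of the second. *)
Lemma intersection_orbits (w : wB) (l : seq (wB * wB)) :
  (\bigcap_(q in [set` l])
     [set (evB q.1)^-1 * h * evB q.2 * x
       | h in stabiliser to s0 & x in powers (evB w)]
   `&` centraliser (evB w) = set0)%classic <->
  ~ exists2 d, commute (evB w) d &
    {in l, forall q, orb (evB w) (to (pt q.1) d) (pt q.2)}.
Proof.
have memE d q : image2 (stabiliser to s0) (powers (evB w))
     (fun h x => (evB q.1)^-1 * h * evB q.2 * x) d <->
   orb (evB w) (to (pt q.1) d) (pt q.2).
  rewrite -ractM; split=> [[h hH [y yw <-]]|/same_orbit_sym/double_coset_orbit].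
    apply: same_orbit_sym; apply/double_coset_orbit.
    by exists h => //; exists y => //; rewrite !mulgA mulgV mul1g.
  move=> [h hH [y yw yE]]; exists h => //; exists y => //.
  by rewrite -(mulKg (evB q.1) d) -yE !mulgA.
split=> [I0 [d wd dl]|no].
  suff : set0 d by [].
  by rewrite -I0; split=> // q ql; apply/memE/dl.
apply/seteqP; split=> // d [dl wd]; apply: no; exists d => // q ql.
exact/memE/dl.
Qed.

End ReducedLists.

(** * The decision procedure *)

Section Words.
Variables (G : groupType) (k : nat) (g : 'I_k -> G).

Lemma eval_word_nil : eval_word g [::] = 1.
Proof. exact: big_nil. Qed.

Lemma eval_word_cons x (w : word k) :
  eval_word g (x :: w) = (if x.2 then (g x.1)^-1 else g x.1) * eval_word g w.
Proof. exact: big_cons. Qed.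

Lemma eval_word_cat (u v : word k) :
  eval_word g (u ++ v) = eval_word g u * eval_word g v.
Proof. exact: big_cat. Qed.

Definition inv_word (w : word k) : word k :=
  foldr (fun x v => v ++ [:: (x.1, ~~ x.2)]) [::] w.

Lemma eval_inv_word w : eval_word g (inv_word w) = (eval_word g w)^-1.
Proof.
elim: w => [|[i e] w IH]; first by rewrite !eval_word_nil invg1.
rewrite /= eval_word_cat IH !eval_word_cons eval_word_nil mulg1 invgM.
by case: e; rewrite //= invgK.
Qed.

End Words.

(** The word problem reduces to the conjugacy problem, because only 1 is conjugate to 1: apply it to
    the word for [u * v^-1] and the empty word. *)
Lemma rcomp_eval_eq (G : groupType) (k : nat) (g : 'I_k.+1 -> G) :
    rcomp (fun p : word k.+1 * word k.+1 =>
      `[< conjugate (eval_word g p.1) (eval_word g p.2) >]) ->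
  forall (T : coded) (u v : T -> word k.+1), rcomp u -> rcomp v ->
  rcomp (fun t => `[< eval_word g (u t) = eval_word g (v t) >]).
Proof.
move=> cg T u v cu cv.
pose w t : word k.+1 * word k.+1 := (u t ++ inv_word (v t), [::]).
have cw : rcomp w by rewrite /w /inv_word; rcomp_auto.
apply: rcomp_ext (rcomp_comp cg cw) => t; apply/asbool_equiv_eq.
rewrite /w /= eval_word_cat eval_inv_word eval_word_nil.
split=> [[z /eqP]|->]; last by exists 1; rewrite mulgV conj1g.
by rewrite conjg_eq1 => /eqP/divg1_eq.
Qed.

Lemma rcomp_matchings (T X Y : coded) (R : T -> X -> Y -> bool)
    (l : T -> seq X) (k : T -> seq Y) :
  rcomp (fun p : T * (X * Y) => R p.1 p.2.1 p.2.2) -> rcomp l -> rcomp k ->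
  rcomp (fun t => matchings (R t) (l t) (k t)).
Proof.
move=> cR cl ck; rewrite /matchings; rcomp_auto.
  by apply: (rcomp_comp cR (f := fun p => (p.1.1, (p.1.2.1, p.2)))); rcomp_auto.
by apply: (rcomp_comp ck (f := fun p => p.1)); rcomp_auto.
Qed.

Lemma conjugate_conj (G : groupType) (x y z t : G) :
  conjugate (x ^ z) (y ^ t) <-> conjugate x y.
Proof.
split=> -[u uE].
  by exists (z * u * t^-1); rewrite !conjgM uE conjgK.
by exists (z^-1 * u * t); rewrite !conjgM conjgK uE.
Qed.

(** * Finite data representing elements of the wreath product *)

Section Representatives.
Variables (A B : groupType) (S : choiceType) (to : right_action B S) (s0 : S).
Variables (m n : nat) (gA : 'I_m.+1 -> A) (gB : 'I_n.+1 -> B).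

Local Notation wA := (word m.+1).
Local Notation wB := (word n.+1).
Local Notation evA := (eval_word gA).
Local Notation evB := (eval_word gB).
Local Notation pt t := (to s0 (evB t)).
Local Notation orb := (same_orbit to).
Local Notation list_fun := (list_fun to s0 gA gB).
Local Notation reduced_list := (reduced_list to s0 gA gB).
Local Notation matching := (matching to s0 gA gB).

(** A word for the base part and a list that denotes the function part through [list_fun]; one
    element has many representatives. *)
Definition rep : Type := wB * seq (wB * wA).

Implicit Types (L : seq (wB * wA)) (r : rep) (s u : S).

Definition rep_val r : wreath A to := Wreath to (evB r.1) (list_fun r.2).

Definition rep_mul r1 r2 : rep :=
  (r1.1 ++ r2.1, [seq (q.1 ++ r2.1, q.2) | q <- r1.2] ++ r2.2).

Lemma list_fun_cat L1 L2 :
  list_fun (L1 ++ L2) = fs_mul (list_fun L1) (list_fun L2).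
Proof.
apply/fsfunP => u; rewrite fs_mulE; elim: L1 => [|q L1 IH].
  by rewrite fsfun0E mul1g.
by rewrite cat_cons !list_fun_cons IH mulgA.
Qed.

Lemma list_fun_translate L t :
  list_fun [seq (q.1 ++ t, q.2) | q <- L] = fs_shift to (list_fun L) (evB t).
Proof.
apply/fsfunP => u; rewrite fs_shiftE; elim: L => [|q L IH].
  by rewrite !fsfun0E.
by rewrite map_cons !list_fun_cons IH eval_word_cat ractM ractV_eq.
Qed.

Lemma rep_mulE r1 r2 : rep_val (rep_mul r1 r2) = rep_val r1 * rep_val r2.
Proof.
rewrite /rep_val /= eval_word_cat list_fun_cat list_fun_translate.
by [].
Qed.

Definition value_at L t : wA :=
  flatten [seq q.2 | q <- L & `[< pt q.1 = pt t >]].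

Lemma value_atE L t : evA (value_at L t) = list_fun L (pt t).
Proof.
rewrite /value_at; elim: L => [|q L IH]; first by rewrite fsfun0E eval_word_nil.
rewrite list_fun_cons -IH /= eq_sym; case: asboolP => [->|/eqP/negPf->].
  by rewrite eqxx /= eval_word_cat.
by rewrite mul1g.
Qed.

Definition rep_eq r1 r2 : bool :=
  `[< evB r1.1 = evB r2.1 >] &&
  all (fun q => `[< evA (value_at r1.2 q.1) = evA (value_at r2.2 q.1) >])
    (r1.2 ++ r2.2).

Lemma list_fun_notin L s : {in L, forall q, pt q.1 <> s} -> list_fun L s = 1.
Proof.
elim: L => [|q L IH] off; first by rewrite fsfun0E.
rewrite list_fun_cons IH => [|q' q'L]; last by apply: off; rewrite inE q'L orbT.
case: eqP => [sq|_]; last by rewrite mulg1.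
by case: (off q (mem_head _ _)).
Qed.

(** Both functions are 1 away from the listed points, so a comparison at finitely many points
    suffices. *)
Lemma rep_eqP r1 r2 : rep_eq r1 r2 <-> rep_val r1 = rep_val r2.
Proof.
case: r1 r2 => [t1 L1] [t2 L2]; rewrite /rep_eq /rep_val /=.
split=> [/andP[/asboolP -> /allP L12]|[-> L12]]; last first.
  rewrite asboolT //=; apply/allP => q _; apply/asboolP.
  by rewrite !value_atE L12.
congr Wreath; apply/fsfunP => s.
have [[q qL <-]|no] := pselect (exists2 q, q \in L1 ++ L2 & pt q.1 = s).
  by rewrite -!value_atE; apply/asboolP/L12.
by rewrite !list_fun_notin // => q qL qs; apply: no; exists q => //;
  rewrite mem_cat qL ?orbT.
Qed.

(** As a point, the empty word stands for [s0], where the generators coming from [A] live. *)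
Definition letter_rep (x : 'I_(n.+1 + m.+1) * bool) : rep :=
  match split x.1 with
  | inl j => ([:: (j, x.2)], [::])
  | inr j => ([::], [:: ([::], [:: (j, x.2)])])
  end.

Definition word_rep (w : word (n.+1 + m.+1)) : rep :=
  foldr (fun x r => rep_mul (letter_rep x) r) ([::], [::]) w.

Lemma rep_val1 : rep_val ([::], [::]) = 1.
Proof. by rewrite /rep_val /= eval_word_nil. Qed.

Lemma letter_repE x : rep_val (letter_rep x) =
  if x.2 then (wr_gen to s0 gA gB x.1)^-1 else wr_gen to s0 gA gB x.1.
Proof.
case: x => i e; rewrite /letter_rep /wr_gen /=; case: (split i) => j.
  rewrite /rep_val /= eval_word_cons eval_word_nil mulg1; case: e => //.
  congr Wreath; apply/fsfunP => s.
  by rewrite fs_shiftE fs_invE !fsfun0E invg1.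
rewrite /rep_val /= eval_word_cons !eval_word_nil mulg1.
case: e; last first.
  congr Wreath; apply/fsfunP => s.
  by rewrite fs_mulE fsfun0E mulg1 !fs_singleE ract1.
congr Wreath; first by rewrite invg1.
apply/fsfunP => s; rewrite fs_mulE fsfun0E mulg1 fs_shiftE fs_invE !fs_singleE.
by rewrite ract1 !invg1 ract1; case: eqP => _; rewrite ?invg1.
Qed.

Lemma word_repE w : rep_val (word_rep w) = eval_word (wr_gen to s0 gA gB) w.
Proof.
elim: w => [|x w IH]; first by rewrite eval_word_nil rep_val1.
by rewrite eval_word_cons -IH -letter_repE -rep_mulE.
Qed.

Lemma rcomp_letter_rep :
  @rcomp (pair_coded (ord_coded (n + m.+1)) bool_coded) _ letter_rep.
Proof.
(* On codes, splitting an index means comparing it with [n] and, for a generator of [A], subtracting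
   [n.+1]. *)
have [F cF FE] : rcomp (fun x : nat * nat =>
    if x.1 <= n then ([:: x], [::])
    else ([::], [:: ([::] : seq (nat * nat), [:: (x.1 - n.+1, x.2)])])).
  by rcomp_auto.
exists F => // -[i e]; have := FE (i : nat, e : nat).
rewrite [cenc (i : nat, e : nat)]/(cenc _) => ->.
rewrite /letter_rep /=; case: splitP => j jE.
  by rewrite jE -ltnS ltn_ord.
by rewrite jE addSn leqNgt ltnS leq_addr /= subSS addKn.
Qed.

(* The first disjunct makes the search for x succeed for all t. *)
Definition is_normal_form (t : rep * wB) (x : rep * seq (wB * wA)) : bool :=
  ~~ `[< conjugate (evB t.1.1) (evB t.2) >] ||
  rep_eq (rep_mul t.1 x.1) (rep_mul x.1 (t.2, x.2)) &&
  reduced_list (evB t.2) x.2.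

(** Assignments that repeat an entry of [L2] do no harm: for reduced lists, a centralising [d]
    carries the distinct orbits of [L1] to distinct orbits, so any assignment it realises is
    injective. *)
Definition conj_test c L1 L2 : bool :=
  (size L1 == size L2) &&
  has (fun a => ~~ `[< (\bigcap_(q in [set` [seq (p.1.1, p.2.1) | p <- a]])
     [set (evB q.1)^-1 * h * evB q.2 * x
       | h in stabiliser to s0 & x in powers (evB c)]
       `&` centraliser (evB c) = set0)%classic >])
    (matchings (fun q q' => `[< matching (evB c) q q' >]) L1 L2).

Section Correctness.
Hypothesis to_transitive : transitive_action to.
Hypothesis genA : forall x : A, exists w, evA w = x.
Hypothesis genB : forall x : B, exists w, evB w = x.

(** Translate by a [d] that conjugates the base part to that of [c], then slide to a reduced
    support. The conjugator is itself represented by data, so the search can recognise the result by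
    an equation between representatives. *)
Lemma is_normal_form_exists t : exists x, is_normal_form t x.
Proof.
case: t => r c; rewrite /is_normal_form /=.
have [/asboolP[d dE]|_] := boolP `[< _ >]; last by exists (r, [::]).
have [f lf red] := loc_conj_reduce to (evB c) (fs_shift to (list_fun r.2) d).
have [L LE redL] := reduced_list_exists s0 to_transitive genA genB red.
have [[b h] bhE] :
    conjugate (rep_val r) (Wreath to (evB c) f).
  by apply/conjugate_wreath; exists d; rewrite // -dE conjgC.
have [t tE] := genB b.
(* Every support is reduced with respect to the trivial element. *)
have [|L' L'E _] := @reduced_list_exists _ _ _ to s0 _ _ _ _
    to_transitive genA genB 1 h.
  by move=> x y _ _ [k]; rewrite expg1n !ract1 => -[].
exists ((t, L'), L); rewrite redL andbT; apply/rep_eqP; rewrite !rep_mulE.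
by rewrite /rep_val /= tE L'E LE -bhE conjgE mulVKg.
Qed.

Lemma is_normal_formE r c x : is_normal_form (r, c) x ->
  conjugate (evB r.1) (evB c) ->
  conjugate (rep_val r) (Wreath to (evB c) (list_fun x.2)) /\
  reduced_list (evB c) x.2.
Proof.
rewrite /is_normal_form /= => /orP[/asboolP nc cj|/andP[/rep_eqP E red] _].
  by case: nc.
by split=> //; exists (rep_val x.1); rewrite conjgE -rep_mulE E rep_mulE mulKg.
Qed.

Lemma conj_testP c L1 L2 :
    reduced_list (evB c) L1 -> reduced_list (evB c) L2 ->
  conj_test c L1 L2 <->
  conjugate (Wreath to (evB c) (list_fun L1)) (Wreath to (evB c) (list_fun L2)).
Proof.
move=> red1 red2; rewrite conjugate_reduced // /conj_test.
(* The condition is split into [R], which does not involve [d] and selects the candidates, and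
   [Q d], which is left to the intersection problem. *)
pose R q q' := `[< matching (evB c) q q' >].
pose Q d (q q' : wB * wA) := orb (evB c) (to (pt q.1) d) (pt q'.1).
split=> [/andP[/eqP sizeE /hasP[a aM]]|[-> [d cd ex]]].
  move=> /asboolPn/intersection_orbits/contrapT[d cd da]; split=> //.
  exists d => // q qL.
  have [|q' q'L [/asboolP mt oq]] := (matchingsP R (Q d) L1 L2).2 _ q qL;
    last by exists q'.
  exists a => // p pa; apply: (da (p.1.1, p.2.1)).
  by apply/mapP; exists p.
rewrite eqxx /=.
have [|a aM aQ] := (matchingsP R (Q d) L1 L2).1 _.
  move=> q /ex[q' q'L [mt oq]]; exists q' => //; split=> //; exact/asboolP.
apply/hasP; exists a => //; apply/asboolPn => /intersection_orbits; apply.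
by exists d => // _ /mapP[p pa ->]; apply: aQ.
Qed.

End Correctness.

(** * Decidability of the tests and of conjugacy *)

Section Decidability.
Hypothesis conjA : rcomp (fun p : wA * wA =>
  `[< conjugate (evA p.1) (evA p.2) >]).
Hypothesis conjB : rcomp (fun p : wB * wB =>
  `[< conjugate (evB p.1) (evB p.2) >]).
Hypothesis memb : rcomp (fun p : wB * wB * wB =>
  `[< [set h * evB p.1.1 * x | h in stabiliser to s0
      & x in powers (evB p.1.2)]%classic (evB p.2) >]).

Lemma rcomp_same_orbit (T : coded) (b t t' : T -> wB) :
  rcomp b -> rcomp t -> rcomp t' ->
  rcomp (fun x => `[< orb (evB (b x)) (pt (t x)) (pt (t' x)) >]).
Proof.
move=> cb ct ct'; apply: rcomp_ext
  (rcomp_comp memb (rcomp_pair (rcomp_pair ct cb) ct')) => x /=.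
apply/asbool_equiv_eq; exact: double_coset_orbit.
Qed.

(** Points are the orbits of the trivial element, given here by the empty word. *)
Lemma rcomp_same_point (T : coded) (t t' : T -> wB) : rcomp t -> rcomp t' ->
  rcomp (fun x => `[< pt (t x) = pt (t' x) >]).
Proof.
move=> ct ct'; apply: rcomp_ext
  (rcomp_same_orbit (rcomp_cst T ([::] : wB)) ct ct') => x /=.
apply/asbool_equiv_eq; rewrite eval_word_nil.
by split=> [[k]|->]; [rewrite expg1n !ract1 => -[] | exact: same_orbit_refl].
Qed.

Lemma rcomp_reduced_list (T : coded) (c : T -> wB)
    (L : T -> seq (wB * wA)) : rcomp c -> rcomp L ->
  rcomp (fun t => reduced_list (evB (c t)) (L t)).
Proof.
move=> cc cL; apply: (@rcomp_ext _ _ (fun t =>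
  all (fun q => ~~ `[< evA q.2 = evA [::] >]) (L t) &&
  pairwise (fun q q' => ~~ `[< orb (evB (c t)) (pt q.1) (pt q'.1) >]) (L t))).
  move=> t; congr andb; apply: eq_all => q.
  by rewrite eval_word_nil; congr negb; apply/asboolP/eqP.
rcomp_auto; first by apply: (rcomp_eval_eq conjA); rcomp_auto.
apply: rcomp_same_orbit; rcomp_auto.
by apply: (rcomp_comp cc (f := fun p => p.1)); rcomp_auto.
Qed.

Lemma rcomp_rep_eq (T : coded) (r1 r2 : T -> wB * seq (wB * wA)) :
  rcomp r1 -> rcomp r2 -> rcomp (fun t => rep_eq (r1 t) (r2 t)).
Proof.
move=> c1 c2; rewrite /rep_eq /value_at; rcomp_auto.
  by apply: (rcomp_eval_eq conjB); rcomp_auto.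
apply: (rcomp_eval_eq conjA); rcomp_auto.
- by apply: rcomp_same_point; rcomp_auto.
- by apply: (rcomp_comp c1 (f := fun p => p.1)); rcomp_auto.
- by apply: rcomp_same_point; rcomp_auto.
- by apply: (rcomp_comp c2 (f := fun p => p.1)); rcomp_auto.
Qed.

Lemma rcomp_is_normal_form :
  rcomp (fun p : (wB * seq (wB * wA) * wB) *
                 (wB * seq (wB * wA) * seq (wB * wA)) =>
    is_normal_form p.1 p.2).
Proof.
rewrite /is_normal_form; rcomp_auto.
- apply: (rcomp_comp conjB (f := fun p => (p.1.1.1, p.1.2))); rcomp_auto.
- by apply: rcomp_rep_eq; rewrite /rep_mul; rcomp_auto.
- by apply: rcomp_reduced_list; rcomp_auto.
Qed.

Hypothesis abelian_or_orbit : (forall x y : A, commute x y) \/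
  rcomp (fun p : wB * wB =>
    `[< finite_set (image (powers (evB p.1)) (to (pt p.2))) >]).

Lemma rcomp_matching (T : coded) (c : T -> wB) (q q' : T -> wB * wA) :
  rcomp c -> rcomp q -> rcomp q' ->
  rcomp (fun t => `[< matching (evB (c t)) (q t) (q' t) >]).
Proof.
move=> cc cq cq'.
have cj : rcomp (fun t => `[< conjugate (evA (q t).2) (evA (q' t).2) >]).
  by apply: (rcomp_comp conjA (f := fun t => ((q t).2, (q' t).2))); rcomp_auto.
case: abelian_or_orbit => [abA|cfin].
  apply: rcomp_ext cj => t; apply/asbool_equiv_eq.
  split=> [[z zE]|[]//]; split; first by exists z.
  by right; rewrite -zE conjgE abA mulgK.
apply: (@rcomp_ext _ _ (fun t =>
  `[< conjugate (evA (q t).2) (evA (q' t).2) >] &&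
  (`[< finite_set (image (powers (evB (c t))) (to (pt (q t).1))) >] ||
   `[< evA (q t).2 = evA (q' t).2 >]))).
  move=> t; rewrite -asbool_or -asbool_and; apply/asbool_equiv_eq.
  by rewrite /matching finite_orbitP.
rcomp_auto; last by apply: (rcomp_eval_eq conjA); rcomp_auto.
by apply: (rcomp_comp cfin (f := fun t => (c t, (q t).1))); rcomp_auto.
Qed.

Hypothesis inter : rcomp (fun p : wB * seq (wB * wB) =>
  `[< (\bigcap_(q in [set` p.2])
     [set (evB q.1)^-1 * h * evB q.2 * x
       | h in stabiliser to s0 & x in powers (evB p.1)]
       `&` centraliser (evB p.1) = set0)%classic >]).

Lemma rcomp_conj_test (T : coded) (c : T -> wB)
    (L1 L2 : T -> seq (wB * wA)) : rcomp c -> rcomp L1 -> rcomp L2 ->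
  rcomp (fun t => conj_test (c t) (L1 t) (L2 t)).
Proof.
move=> cc c1 c2; rewrite /conj_test.
apply: rcomp_andb; first by apply: rcomp_eqn; rcomp_auto.
apply: rcomp_has; last first.
  apply: rcomp_matchings => //; apply: rcomp_matching; rcomp_auto.
  by apply: (rcomp_comp cc (f := fun p => p.1)); rcomp_auto.
apply: rcomp_negb.
apply: (rcomp_comp inter
  (f := fun p : T * seq ((wB * wA) * (wB * wA)) =>
    (c p.1, [seq (x.1.1, x.2.1) | x <- p.2]))); rcomp_auto.
by apply: (rcomp_comp cc (f := fun p => p.1)); rcomp_auto.
Qed.

Hypothesis to_transitive : transitive_action to.
Hypothesis genA : forall x : A, exists w, evA w = x.
Hypothesis genB : forall x : B, exists w, evB w = x.

Lemma rcomp_word_rep (T : coded) (w : T -> word (n + m.+1).+1) :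
  rcomp w -> rcomp (fun t => word_rep (w t)).
Proof.
move=> cw; rewrite /word_rep /rep_mul; rcomp_auto.
all: by apply: (rcomp_comp rcomp_letter_rep (f := fun p => p.2.1)); rcomp_auto.
Qed.

(** Compare the base parts first; if they are conjugate, bring both elements to normal form over the
    base part of the second and test the two lists. *)
Lemma wreath_conjugacy_rcomp :
  rcomp (fun p : word (n + m.+1).+1 * word (n + m.+1).+1 =>
    `[< conjugate (eval_word (wr_gen to s0 gA gB) p.1)
                  (eval_word (wr_gen to s0 gA gB) p.2) >]).
Proof.
have [nf cnf nfP] := rcomp_search rcomp_is_normal_form
  (is_normal_form_exists to_transitive genA genB).
pose c (p : word (n + m.+1).+1 * word (n + m.+1).+1) := (word_rep p.2).1.
have cc : rcomp c by rewrite /c; rcomp_auto; apply: rcomp_word_rep; rcomp_auto.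
apply: (@rcomp_ext _ _ (fun p =>
  `[< conjugate (evB (word_rep p.1).1) (evB (c p)) >] &&
  conj_test (c p) (nf (word_rep p.1, c p)).2 (nf (word_rep p.2, c p)).2));
  last first.
  apply: rcomp_andb.
    apply: (rcomp_comp conjB (f := fun p => ((word_rep p.1).1, c p)));
      rcomp_auto.
    by apply: rcomp_word_rep; rcomp_auto.
  apply: rcomp_conj_test => //; apply: rcomp_snd.
    apply: (rcomp_comp cnf (f := fun p => (word_rep p.1, c p))); rcomp_auto.
    by apply: rcomp_word_rep; rcomp_auto.
  apply: (rcomp_comp cnf (f := fun p => (word_rep p.2, c p))); rcomp_auto.
  by apply: rcomp_word_rep; rcomp_auto.
move=> [w1 w2]; rewrite /c /=; set b := (word_rep w2).1.
rewrite -!word_repE.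
(* Without conjugate base parts the normal form of the first element is meaningless, but the first
   test already fails. *)
have [cb|ncb] := pselect (conjugate (evB (word_rep w1).1) (evB b)); last first.
  rewrite asboolF //=; apply/esym/asboolF => /conjugate_wreath[d dE _].
  by apply: ncb; exists d; rewrite conjgE dE mulKg.
rewrite asboolT //=.
have [] := is_normal_formE (nfP (word_rep w1, b)) cb.
have [] := is_normal_formE (nfP (word_rep w2, b)) (ex_intro _ 1 (conjg1 _)).
move=> [z2 z2E] red2 [z1 z1E] red1.
by apply/idP/asboolP; rewrite conj_testP // -z1E -z2E conjugate_conj.
Qed.

End Decidability.
End Representatives.

(** Decoding letters needs at least one generator, and a nontrivial group provides it. *)
Lemma generated_nontrivial (G : groupType) (k : nat) (g : 'I_k -> G) :
  (forall x : G, exists w, eval_word g w = x) -> (exists x : G, x <> 1) ->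
  0 < k.
Proof.
case: k g => // g gen [x]; have [w <-] := gen x.
by case: w => [|[[]]//]; rewrite eval_word_nil.
Qed.

Theorem theorem1p0p2 (A B : groupType) (S : choiceType)
    (to : right_action B S) (s0 : S) (m n : nat)
    (gA : 'I_m -> A) (gB : 'I_n -> B)
    (A_nontrivial : exists a : A, a <> 1%g)
    (B_nontrivial : exists b : B, b <> 1%g)
    (A_rec_pres : recursively_presented gA)
    (B_rec_pres : recursively_presented gB)
    (to_transitive : transitive_action to)
    (conj_AB : conjugacy_problem_solvable gA /\ conjugacy_problem_solvable gB)
    (abelian_or_orbit : (forall x y : A, commute x y) \/
       orbit_order_problem_solvable to s0 gB)
    (membership : membership_problem_solvable to s0 gB)
    (intersection : centraliser_intersection_problem_solvable to s0 gB) :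
  conjugacy_problem_solvable (wr_gen to s0 gA gB).
Proof.
have [_ _ [genA _]] := A_rec_pres; have [_ _ [genB _]] := B_rec_pres.
have m0 := generated_nontrivial genA A_nontrivial.
have n0 := generated_nontrivial genB B_nontrivial.
case: m gA m0 A_rec_pres genA conj_AB => // m gA _ _ genA [conjA conjB].
case: n gB n0 B_rec_pres genB conjB abelian_or_orbit membership intersection
  => // n gB _ _ genB conjB abelian_or_orbit membership intersection.
(* The coding of [W] is [code_word] up to conversion, so realisability and the decision problems as
   stated refer to the same codes. *)
pose W := seq_coded (pair_coded (ord_coded (n + m.+1)) bool_coded).
apply/(@decided_rcomp (pair_coded W W)).
apply: wreath_conjugacy_rcomp => //.
- exact/decided_rcomp.
- exact/decided_rcomp.
- exact/decided_rcomp.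
- by case: abelian_or_orbit => [?|?]; [left|right; exact/decided_rcomp].
- exact/decided_rcomp.
Qed.
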